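(* Let $F:\mathbb{R}^n\rightrightarrows\mathbb{R}^n$ be upper semicontinuous and locally Lipschitz, with $F(x)$ compact and convex for every $x\in\mathbb{R}^n$, and suppose the system $\dot x\in F(x)$ is backward complete. Let $X_o,X_u\subset\mathbb{R}^n$ with $X_o$ closed and $X_o\cap X_u=\emptyset$. Then the system $\dot x\in F(x)$ is safe with respect to $(X_o,X_u)$ if and only if there exists a locally Lipschitz time-varying barrier function candidate $B:\mathbb{R}_{\geq0}\times\mathbb{R}^n\to\mathbb{R}$ for safety with respect to $(X_o,X_u)$ that satisfies property $(\star\star)$.
   Context: A solution of $\dot x\in F(x)$ starting from $x_o$ is a locally absolutely continuous function $\phi:\operatorname{dom}\phi\to\mathbb{R}^n$, where $\operatorname{dom}\phi$ is $[0,T]$ or $[0,T)$ for some $T\in[0,\infty]$, with $\phi(0)=x_o$ and $\dot\phi(t)\in F(\phi(t))$ for almost all $t\in\operatorname{dom}\phi$. A solution is maximal if it cannot be extended to a solution with strictly larger domain; a system is forward complete if every maximal solution has unbounded domain. The system $\dot x\in F(x)$ is backward complete if $\dot x\in -F(x)$ is forward complete. Safety with respect to $(X_o,X_u)$: every solution starting in $X_o$ never takes values in $X_u$. A time-varying barrier function candidate for safety with respect to $(X_o,X_u)$ is $B:\mathbb{R}_{\geq0}\times\mathbb{R}^n\to\mathbb{R}$ with $B>0$ on $\mathbb{R}_{\geq0}\times X_u$ and $B\le 0$ on $\mathbb{R}_{\geq0}\times X_o$. Let $K:=\{(t,x): B(t,x)\le 0\}$ (interior taken in $\mathbb{R}_{\geq0}\times\mathbb{R}^n$).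 Property $(\star\star)$: there is an open neighborhood $U(K)$ of $K$ such that, along each solution of $(\dot t,\dot x)\in\{1\}\times F(x)$ starting from a point of $U(K)\setminus\operatorname{int}(K)$ and remaining in $U(K)\setminus\operatorname{int}(K)$ on a time interval, the map $t\mapsto B(t,\phi(t))$ is nonincreasing on that interval. $F$ is upper semicontinuous if for each $x$, $\epsilon>0$ there is a neighborhood $U$ of $x$ with $F(y)\subset F(x)+\epsilon\mathbb{B}$ for $y\in U$. $F$ is locally Lipschitz if for each compact $K_o\subset\mathbb{R}^n$ there is $k>0$ with $F(x_1)\subset F(x_2)+k|x_1-x_2|\mathbb{B}$ for all $x_1,x_2\in K_o$. *)

(* Defs.v *)
From HB Require Import structures.
From mathcomp Require Import all_boot all_order all_algebra.
From mathcomp Require Import all_classical all_reals all_analysis.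
Set Implicit Arguments. Unset Strict Implicit. Unset Printing Implicit Defensive.
Import Order.TTheory GRing.Theory Num.Theory.
Import numFieldNormedType.Exports.
Local Open Scope classical_set_scope.
Local Open Scope ring_scope.

Section Defs.
Variable R : realType.

Definition is_sol_domain (D : set R) : Prop :=
  (exists T : R, 0 <= T /\ D = `[0, T]%classic) \/
  (exists T : \bar R, (0 <= T)%E /\ D = [set t | 0 <= t /\ (t%:E < T)%E]).

Definition abs_cont_on (V : normedModType R) (a b : R) (phi : R -> V) : Prop :=
  forall eps : R, 0 < eps -> exists2 delta : R, 0 < delta &
    forall (k : nat) (u v : 'I_k -> R),
      (forall i, a <= u i /\ u i <= v i /\ v i <= b) ->
      (forall i j, i != j -> v i <= u j \/ v j <= u i) ->
      \sum_(i < k) (v i - u i) < delta ->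
      \sum_(i < k) `|phi (v i) - phi (u i)| < eps.

Definition loc_abs_cont (V : normedModType R) (D : set R) (phi : R -> V) : Prop :=
  forall a b : R, a <= b -> `[a, b]%classic `<=` D -> abs_cont_on a b phi.

Definition is_solution (V : normedModType R) (F : V -> set V) (x0 : V)
    (D : set R) (phi : R -> V) : Prop :=
  [/\ is_sol_domain D, phi 0 = x0, loc_abs_cont D phi &
      exists N : set R, (@lebesgue_measure R).-negligible N /\
        forall t, D t -> ~ N t -> derivable phi t 1 /\ F (phi t) ('D_1 phi t)].

Definition is_maximal_solution (V : normedModType R) (F : V -> set V) (x0 : V)
    (D : set R) (phi : R -> V) : Prop :=
  is_solution F x0 D phi /\
  ~ (exists (D' : set R) (psi : R -> V), is_solution F x0 D' psi /\
       D `<=` D' /\ ~ (D' `<=` D) /\ (forall t, D t -> psi t = phi t)).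

Definition forward_complete (V : normedModType R) (F : V -> set V) : Prop :=
  forall x0 D phi, @is_maximal_solution V F x0 D phi ->
    forall M : R, exists t, D t /\ M < t.

Definition backward_complete (V : normedModType R) (F : V -> set V) : Prop :=
  forward_complete (fun x => [set v | F x (- v)]).

Definition is_safe (n : nat) (F : 'rV[R]_n -> set 'rV[R]_n) (Xo Xu : set 'rV[R]_n) : Prop :=
  forall x0, Xo x0 -> forall D phi, is_solution F x0 D phi ->
    forall t, D t -> ~ Xu (phi t).

Definition usc (n : nat) (F : 'rV[R]_n -> set 'rV[R]_n) : Prop :=
  forall x (eps : R), 0 < eps -> exists U, nbhs x U /\
    forall y, U y -> forall v, F y v -> exists w, F x w /\ `|v - w| <= eps.

Definition sv_loc_lipschitz (n : nat) (F : 'rV[R]_n -> set 'rV[R]_n) : Prop :=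
  forall Ko : set 'rV[R]_n, compact Ko -> exists2 k : R, 0 < k &
    forall x1 x2, Ko x1 -> Ko x2 -> forall y, F x1 y ->
      exists z, F x2 z /\ `|y - z| <= k * `|x1 - x2|.

(* time-varying barrier functions, B : R_{>=0} x R^n -> R (values at t < 0 irrelevant) *)
Definition barrier_candidate (n : nat) (B : R * 'rV[R]_n -> R) (Xo Xu : set 'rV[R]_n) : Prop :=
  (forall t x, 0 <= t -> Xu x -> 0 < B (t, x)) /\
  (forall t x, 0 <= t -> Xo x -> B (t, x) <= 0).

Definition fun_loc_lipschitz (n : nat) (B : R * 'rV[R]_n -> R) : Prop :=
  forall Ko : set (R * 'rV[R]_n), compact Ko -> Ko `<=` [set p | 0 <= p.1] ->
    exists k : R, forall p q, Ko p -> Ko q -> `|B p - B q| <= k * `|p - q|.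

Definition sublevelK (n : nat) (B : R * 'rV[R]_n -> R) : set (R * 'rV[R]_n) :=
  [set p | 0 <= p.1 /\ B p <= 0].

Definition rel_interior (n : nat) (S : set (R * 'rV[R]_n)) : set (R * 'rV[R]_n) :=
  [set p | S p /\ exists2 e : R, 0 < e &
     forall q, 0 <= q.1 -> `|q - p| < e -> S q].

Definition rel_open (n : nat) (U : set (R * 'rV[R]_n)) : Prop :=
  U `<=` [set p | 0 <= p.1] /\
  forall p, U p -> exists2 e : R, 0 < e & forall q, 0 <= q.1 -> `|q - p| < e -> U q.

Definition aug_sys (n : nat) (F : 'rV[R]_n -> set 'rV[R]_n) :
    R * 'rV[R]_n -> set (R * 'rV[R]_n) :=
  fun p => [set q | q.1 = 1 /\ F p.2 q.2].

Definition property_star_star (n : nat) (F : 'rV[R]_n -> set 'rV[R]_n)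
    (B : R * 'rV[R]_n -> R) : Prop :=
  exists U : set (R * 'rV[R]_n),
    rel_open U /\ sublevelK B `<=` U /\
    forall p0 D (psi : R -> R * 'rV[R]_n),
      is_solution (aug_sys F) p0 D psi ->
      (U `\` rel_interior (sublevelK B)) p0 ->
      forall s, D s ->
      (forall r, 0 <= r -> r <= s -> (U `\` rel_interior (sublevelK B)) (psi r)) ->
      forall r1 r2, 0 <= r1 -> r1 <= r2 -> r2 <= s -> B (psi r2) <= B (psi r1).

End Defs.

(* Main.v *)
Require Import Defs.
From HB Require Import structures.
From mathcomp Require Import all_boot all_order all_algebra.
From mathcomp Require Import all_classical all_reals all_analysis.
From mathcomp Require Import ring lra.
Import Order.TTheory GRing.Theory Num.Theory.
Import numFieldNormedType.Exports.
Local Open Scope classical_set_scope.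
Local Open Scope ring_scope.
Set Implicit Arguments. Unset Strict Implicit. Unset Printing Implicit Defensive.

(** The barrier is B(t, x) = the infimum of the distance to Xo over all points reached
    from x in time at most t by the reversed system x' in -F(x).  Following a solution
    forward only adds backward trajectories, so B does not increase along solutions; B is
    Lipschitz because trajectories from nearby points can be made to track each other
    (Filippov); and B > 0 on Xu because, when B(t, x) = 0, a limit of backward
    trajectories joins x to Xo.

    Trajectories are handled without integrals: for convex values and Lipschitz F, an
    absolutely continuous curve solves the inclusion iff each increment phi t - phi s lies
    within O((t - s)^2) of (t - s) F(phi s).  One direction is a mean value theorem for
    absolutely continuous curves, the other is the almost everywhere differentiability of
    Lipschitz functions.  The increment condition is stable under pointwise limits along
    an ultrafilter, which turns Euler polygons into tracking trajectories and shows that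
    completeness bounds the reachable sets. *)

(** * Almost everywhere differentiability of Lipschitz functions *)

Section lipschitz_derivable.
Variable R : realType.
Notation mu := (@lebesgue_measure R).

(** The estimates need one speed bound and one Lipschitz constant valid everywhere, whereas [F] has
    them only on compact sets. Hence the truncation: composing with a retraction onto a ball gives
    global constants and changes nothing inside the ball. Curves of the truncated system must then
    be recognised as genuine trajectories, which takes an a priori bound on all trajectories issued
    from a ball up to a given time. Completeness speaks of one solution at a time; making it uniform
    is the main compactness step. The bound depends on the horizon, and this is why the barrier
    looks back over a time [t] only: over a finite horizon backward reachable sets are bounded and a
    vanishing infimum is attained, while over an infinite one both may fail. The barrier is never
    negative, so its sublevel set is its zero set: the points that [Xo] reaches within time [t].
    Safety says that this set misses [Xu] for every [t]. The converse direction studies the last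
    time at which a barrier is nonpositive along a solution. *)

Lemma half_lipschitz_ae_derivable (f : R -> R) (a b : R) :
  (forall x y, `|f x - f y| <= 2^-1 * `|x - y|) ->
  {ae mu, forall x, a < x < b -> derivable f x 1}.
Proof.
move=> lipf.
have cf : continuous f.
  move=> x; apply/cvgrPdist_lt => e e0; near=> y.
  apply: (le_lt_trans (lipf _ _)).
  have : `|x - y| < e by near: y; apply: cvgr_dist_lt.
  have := normr_ge0 (x - y); lra.
(* Both [g1] and [g2] are nondecreasing since [f] has Lipschitz constant 1/2, and they sum to the
   identity. Their Stieltjes measures thus sum to Lebesgue measure, so that of [g1] has a density,
   and differentiating the integral of this density differentiates [g1], hence [f]. *)
pose g1 : R -> R := fun x => 2^-1 * x + f x.
pose g2 : R -> R := fun x => 2^-1 * x - f x.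
have nd1 : {homo g1 : x y / x <= y}.
  move=> x y xy; have := lipf y x; rewrite /g1 [X in _ * X]ger0_norm ?subr_ge0//.
  rewrite ler_norml; lra.
have nd2 : {homo g2 : x y / x <= y}.
  move=> x y xy; have := lipf y x; rewrite /g2 [X in _ * X]ger0_norm ?subr_ge0//.
  rewrite ler_norml; lra.
have rc1 : right_continuous g1.
  apply/right_continuousW => x; apply: cvgD; last exact: cf.
  by apply: cvgM; [exact: cvg_cst|exact: cvg_id].
have rc2 : right_continuous g2.
  apply/right_continuousW => x; apply: cvgB; last exact: cf.
  by apply: cvgM; [exact: cvg_cst|exact: cvg_id].
pose c1 : cumulative R R := HB.pack g1 (isCumulative.Build R _ R g1 nd1 rc1).
pose c2 : cumulative R R := HB.pack g2 (isCumulative.Build R _ R g2 nd2 rc2).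
pose nu1 : {measure set (measurableTypeR R) -> \bar R} := lebesgue_stieltjes_measure c1.
pose nu2 : {measure set (measurableTypeR R) -> \bar R} := lebesgue_stieltjes_measure c2.
have nuE (c : cumulative R R) u v : u <= v ->
    lebesgue_stieltjes_measure c `]u, v]%classic = (c v - c u)%:E.
  move=> uv; rewrite /lebesgue_stieltjes_measure/= /measure_extension measurable_mu_extE/=; last exact: is_ocitv.
  by rewrite wlength_itv_bnd.
have nu1E u v : u <= v -> nu1 `]u, v]%classic = (g1 v - g1 u)%:E by exact: nuE.
have nu2E u v : u <= v -> nu2 `]u, v]%classic = (g2 v - g2 u)%:E by exact: nuE.
have muE : forall A, measurable A -> mu A = measure_add nu1 nu2 A.
  apply: lebesgue_measure_unique => X [[u v] _ <-].
  rewrite [RHS]measure_addE /=; have [uv|vu] := leP u v; last first.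
    have -> : `]u, v]%classic = set0 by rewrite set_itv_ge// bnd_simp -leNgt ltW.
    by rewrite !measure0 adde0.
  rewrite nu1E// nu2E// /lebesgue_measure nuE//= -EFinD; congr (_%:E); rewrite /g1 /g2; lra.
have mD : measurable (`]a, b]%classic : set (measurableTypeR R)) by exact: measurable_itv.
have nuD : (nu1 `]a, b]%classic < +oo)%E.
  have [ab|ab] := leP a b; first by rewrite nu1E// ltry.
  have -> : `]a, b]%classic = set0 by rewrite set_itv_ge// bnd_simp -leNgt ltW.
  by rewrite measure0 ltry.
(* Restricting to a bounded interval makes the measure finite, so its density is integrable on the
   whole line and can be integrated from minus infinity. *)
pose nu : {finite_measure set (measurableTypeR R) -> \bar R} := mfrestr mD nuD.
have nu_mu : nu `<< mu.
  apply/null_content_dominatesP => A mA /= muA0.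
  have := muE _ mA; rewrite muA0 measure_addE => /esym/eqP.
  rewrite padde_eq0 ?measure_ge0// => /andP[/eqP nu10 _].
  rewrite /nu /mfrestr /mrestr/=; apply/eqP; rewrite eq_le measure_ge0 andbT.
  rewrite -nu10; apply: le_measure; rewrite ?inE//; exact: measurableI.
have [h [h0 hfin hint hE]] := radon_nikodym_sigma_finite nu_mu.
pose h' := fine \o h.
have hh' : h = EFin \o h' by apply/funext => x; rewrite /h' /= fineK.
rewrite hh' in hint.
have hloc : locally_integrable setT h'.
  by have := integrable_locally measurableT hint; rewrite patch_setT.
have hint' y : mu.-integrable `]-oo, y] (EFin \o h').
  exact: (integrableS measurableT).
have := FTC1Ny hint' hloc; apply: filterS; first exact: (ae_filter_ringOfSetsType mu).
move=> x /= [+ _] /andP[ax xb].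
pose Fi (y : R) := (\int[mu]_(t in [set` `]-oo, y]]) h' t)%R.
have FE y : a < y < b -> Fi y = g1 y - g1 a.
  move=> /andP[ay yb]; rewrite /Fi /Rintegral.
  have -> : (\int[mu]_(t in [set` `]-oo, y]]) (h' t)%:E)%E = nu [set` `]-oo, y]].
    by rewrite hE; [apply: eq_integral => z _; rewrite hh'|exact: measurable_itv].
  have -> : nu [set` `]-oo, y]] = nu1 ([set` `]-oo, y]] `&` `]a, b]%classic) by [].
  rewrite (_ : _ `&` _ = `]a, y]%classic); last first.
    apply/seteqP; split => z; rewrite /= !in_itv/=; first by move=> [-> /andP[-> _]].
    by move=> /andP[-> zy]; rewrite zy (le_trans zy (ltW yb)).
  by rewrite nu1E ?(ltW ay).
rewrite -[X in derivable X]/Fi; move: Fi FE => Fi FE dF {hE hh' hint hloc hint' nu_mu}.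
have d2 : derivable (fun y : R => g1 a - 2^-1 * y) x 1.
  apply: derivableB; first exact: derivable_cst.
  by apply: derivableM; [exact: derivable_cst|exact: derivable_id].
apply: near_eq_derivable (derivableD dF d2).
near=> y.
have ay : a < y by near: y; exact: lt_nbhsr.
have yb : y < b by near: y; exact: lt_nbhsl.
change (Fi y + (g1 a - 2^-1 * y) = f y); rewrite FE ?ay// /g1; lra.
Unshelve. all: by end_near. Qed.

Lemma lipschitz_ae_derivable (f : R -> R) (M a b : R) :
  (forall x y, `|f x - f y| <= M * `|x - y|) ->
  {ae mu, forall x, a < x < b -> derivable f x 1}.
Proof.
move=> lipf; pose c := 2 * (`|M| + 1).
have c0 : 0 < c by rewrite /c; have := normr_ge0 M; lra.
have lipg x y : `|c^-1 * f x - c^-1 * f y| <= 2^-1 * `|x - y|.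
  rewrite -mulrBr normrM gtr0_norm ?invr_gt0// ler_pdivrMl//.
  apply: (le_trans (lipf _ _)); rewrite mulrA ler_wpM2r// /c.
  have := ler_norm M; lra.
have := @half_lipschitz_ae_derivable _ a b lipg; apply: filterS; first exact: (ae_filter_ringOfSetsType mu).
move=> x /= dx xab.
have -> : f = (fun x => c * (c^-1 * f x)).
  by apply/funext => y; rewrite mulVKf// gt_eqF.
by apply: derivableM; [exact: derivable_cst|exact: dx].
Qed.
End lipschitz_derivable.

(** * Mean value theorem for absolutely continuous curves *)

Section mean_value.
Variable R : realType.
Notation mu := (@lebesgue_measure R).

(** A supremum argument for properties of intervals that can be glued. With [P s t] an estimate on
    [s, t] it passes from local to global; with [P s t] an implication from [0, s] to [0, t] it is a
    continuation principle. *)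
Lemma cousin (a b : R) (P : R -> R -> Prop) : a <= b ->
  (forall s t u, a <= s -> s <= t -> t <= u -> u <= b -> P s t -> P t u -> P s u) ->
  (forall x, a <= x -> x <= b -> exists2 d : R, 0 < d &
     forall s t, a <= s -> s <= x -> x <= t -> t <= b -> x - d < s -> t < x + d -> P s t) ->
  P a b.
Proof.
move=> ab Padd Ploc.
pose E := [set t | [/\ a <= t, t <= b & P a t]].
have Ea : E a.
  have [d d0 H] := Ploc a (lexx _) ab; split => //; apply: H => //; lra.
have Eub : ubound E b by move=> t [].
have supE : has_sup E by split; [exists a | exists b].
have ac : a <= sup E by apply: sup_upper_bound.
have cb : sup E <= b by apply: ge_sup; first by exists a.
have [d d0 H] := Ploc _ ac cb.
have [t [at_ tb Pat] ct] := sup_adherent d0 supE.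
have tc : t <= sup E by apply: sup_upper_bound.
pose t' := Num.min b (sup E + d / 2).
have t'b : t' <= b by rewrite ge_min lexx.
have ct' : sup E <= t' by rewrite le_min cb /=; lra.
have t'd : t' < sup E + d by rewrite gt_min; apply/orP; right; lra.
have Pt' : P a t' by apply: (Padd a t t') => //; [lra|exact: H].
have : t' <= sup E by apply: sup_upper_bound => //; split => //; lra.
rewrite ge_min => /orP[bc|]; last lra.
have -> // : b = t'; apply/eqP; rewrite eq_le t'b andbT; lra.
Qed.

Lemma derivable_linear_approx (V : normedModType R) (phi : R -> V) (x e : R) :
  derivable phi x 1 -> 0 < e -> exists2 d : R, 0 < d & forall y, `|y - x| < d ->
    `|phi y - phi x - (y - x) *: 'D_1 phi x| <= e * `|y - x|.
Proof.
move=> dphi e0; have /cvgrPdist_le /(_ _ e0) [d /= d0 H] := dphi.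
exists d => // y yx; have [->|yNx] := eqVneq y x; first by rewrite !subrr scale0r subr0 !normr0 mulr0.
have h0 : y - x != 0 by rewrite subr_eq0.
have := H (y - x); rewrite /= sub0r normrN => /(_ yx h0).
rewrite -[(y - x) *: 1]/((y - x) * 1) mulr1 subrK -[lim _]/('D_1 phi x) => {}H.
have -> : phi y - phi x - (y - x) *: 'D_1 phi x =
   - ((y - x) *: ('D_1 phi x - (y - x)^-1 *: (phi y - phi x))).
  by rewrite scalerBr scalerA divff// scale1r opprB.
by rewrite normrN normrZ mulrC ler_wpM2r.
Qed.

(* The time spent near the exceptional null set is controlled by absolute continuity;
   elsewhere increments follow the derivative. *)
Lemma abs_cont_mean_value (V : normedModType R) (a b : R) (phi : R -> V) (C : set V)
    (L : R) (N : set R) :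
  a <= b -> abs_cont_on a b phi -> mu.-negligible N -> C !=set0 ->
  (forall x y p q, C x -> C y -> 0 <= p -> 0 <= q -> p + q = 1 -> C (p *: x + q *: y)) ->
  (forall w, C w -> `|w| <= L) ->
  (forall t, a <= t -> t <= b -> ~ N t -> derivable phi t 1 /\ C ('D_1 phi t)) ->
  forall e, 0 < e -> exists2 w, C w & `|phi b - phi a - (b - a) *: w| <= e.
Proof.
move=> ab acphi negN [w0 Cw0] convC bndC Hphi e e0.
have L0 : 0 <= L by rewrite (le_trans _ (bndC _ Cw0)).
have [dl dl0 Hdl] := acphi (e / 3) ltac:(lra).
(* The first bound makes the intervals covering [N] short enough for [Hdl]; the second makes a
   displacement at speed [L] during their total length cost at most [e / 3]. *)
pose dl' := Num.min dl (e / 3 / (L + 1)).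
have dl'0 : 0 < dl' by rewrite lt_min dl0 /= divr_gt0//; lra.
have [U [oU NU muU]] := @outer_measure_open_le R N (dl' / 2) ltac:(lra).
have /negligible_outer_measure N0 := negN.
rewrite N0 add0e in muU.
have mU : measurable U by exact: measurable_realfun.open_measurable.
pose m s t := fine (mu (U `&` `]s, t]%classic)).
have mfin s t : mu (U `&` `]s, t]%classic) \is a fin_num.
  rewrite ge0_fin_numE//; apply: le_lt_trans (ltry (dl' / 2)).
  apply: le_trans muU; apply: le_measure; rewrite ?inE//; exact: measurableI.
have madd s t u : s <= t -> t <= u -> m s u = m s t + m t u.
  move=> st tu; rewrite /m -fineD//; congr fine.
  rewrite -measureU; [|exact: measurableI|exact: measurableI|]; last first.
    apply/seteqP; split => z //= []; rewrite !in_itv/= => -[_ /andP[_ zt]] [_ /andP[tz _]].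
    by move: (le_lt_trans zt tz); rewrite ltxx.
  by rewrite -setIUr -itv_bndbnd_setU// ?bnd_simp.
have mle : m a b <= dl' / 2.
  rewrite -lee_fin fineK//; apply: le_trans muU.
  apply: le_measure; rewrite ?inE//; exact: measurableI.
have m0 s t : 0 <= m s t by rewrite fine_ge0.
pose eta := e / 3 / (b - a + 1).
have eta0 : 0 < eta by rewrite divr_gt0//; lra.
pose rl (p q : R * R) := p.2 <= q.1.
(* [l] lists the subintervals placed around points of [N]; their length is charged to the additive
   [m], so the whole estimate can be glued. The error has one term for the points of
   differentiability and two for [l]: the displacement attributed to an arbitrary velocity, and the
   true increments of [phi]. *)
pose Good s t := exists l : seq (R * R), [/\
   forall p, p \in l -> [/\ s <= p.1, p.1 <= p.2 & p.2 <= t],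
   pairwise rl l, \sum_(p <- l) (p.2 - p.1) <= m s t &
   exists2 w, C w & `|phi t - phi s - (t - s) *: w| <=
     eta * (t - s) + L * m s t + \sum_(p <- l) `|phi p.2 - phi p.1|].
have : Good a b.
  apply: cousin => //.
    move=> s t u as_ st tu ub [l1 [h1 p1 s1 [w1 Cw1 H1]]] [l2 [h2 p2 s2 [w2 Cw2 H2]]].
    exists (l1 ++ l2); split.
    - move=> p; rewrite mem_cat => /orP[/h1|/h2] [? ? ?]; split; lra.
    - rewrite pairwise_cat p1 p2 !andbT; apply/allrelP => p q /h1[? ? ?] /h2[? ? ?].
      rewrite /rl; lra.
    - by rewrite big_cat/= (madd s t u)// lerD.
    have [su|su] := eqVneq s u.
      have ? : s = t by lra.
      subst u t; exists w0 => //; rewrite !subrr scale0r subr0 normr0 mulr0 add0r.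
      by rewrite addr_ge0// ?mulr_ge0// sumr_ge0.
    have us : 0 < u - s by rewrite subr_gt0 lt_neqAle su; lra.
    (* The time-weighted average of the two velocities has as displacement the sum of theirs. *)
    exists ((t - s) / (u - s) *: w1 + (u - t) / (u - s) *: w2).
      apply: convC => //; [by rewrite divr_ge0//; lra..|].
      by rewrite -mulrDl (_ : t - s + (u - t) = u - s) ?divff ?gt_eqF//; lra.
    rewrite scalerDr !scalerA ![(u - s) * _]mulrC !divfK ?gt_eqF//.
    have -> : phi u - phi s - ((t - s) *: w1 + (u - t) *: w2) =
      (phi u - phi t - (u - t) *: w2) + (phi t - phi s - (t - s) *: w1).
      by rewrite addrACA subrKA; congr (_ + _); rewrite opprD addrC.
    apply: (le_trans (ler_normD _ _)); apply: (le_trans (lerD H2 H1)).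
    rewrite big_cat/= (madd s t u)//; lra.
  move=> x ax xb; have [Nx|Nx] := pselect (N x).
    have [d /= d0 Hd] : nbhs x U by apply: open_nbhs_nbhs; split => //; exact: NU.
    exists d => // s t as_ sx xt tb xds txd.
    have mst : m s t = t - s.
      rewrite /m setIidr; last first.
        move=> z /=; rewrite in_itv/= => /andP[sz zt]; apply: Hd => /=.
        by rewrite distrC ltr_distl; lra.
      rewrite lebesgue_measure_itv/= lte_fin; case: ltP => // ts.
      have -> : s = t by lra.
      by rewrite subrr.
    exists [:: (s, t)]; rewrite !big_seq1/= mst; split => //.
      by move=> p; rewrite inE => /eqP -> /=; split; lra.
    exists w0 => //; apply: (le_trans (ler_normB _ _)).
    rewrite normrZ ger0_norm ?subr_ge0; last lra.
    have : (t - s) * `|w0| <= L * (t - s) by rewrite mulrC ler_wpM2r ?bndC//; lra.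
    have : 0 <= eta * (t - s) by rewrite mulr_ge0//; lra.
    lra.
  have [dphi Cphi] := Hphi _ ax xb Nx.
  have [d d0 H] := derivable_linear_approx dphi eta0.
  exists d => // s t as_ sx xt tb xds txd; exists [::]; rewrite !big_nil; split => //.
  exists ('D_1 phi x) => //; rewrite addr0.
  have -> : phi t - phi s - (t - s) *: 'D_1 phi x =
    (phi t - phi x - (t - x) *: 'D_1 phi x) - (phi s - phi x - (s - x) *: 'D_1 phi x).
    have -> : (t - s) *: 'D_1 phi x = (t - x) *: 'D_1 phi x - (s - x) *: 'D_1 phi x.
      by rewrite -scalerBl; congr (_ *: _); lra.
    by rewrite opprD [in RHS]opprD [RHS]addrACA; congr (_ + _); rewrite opprB addrA subrK.
  apply: (le_trans (ler_normB _ _)).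
  have := H t; rewrite ger0_norm ?subr_ge0// => /(_ ltac:(lra)) H1.
  have := H s; rewrite ler0_norm ?subr_le0// => /(_ ltac:(lra)) H2.
  have := mulr_ge0 L0 (m0 s t); lra.
move=> [l [hl pl sl [w Cw H]]]; exists w => //; apply: (le_trans H).
have h1 : eta * (b - a) <= e / 3.
  by rewrite /eta mulrAC ler_pdivrMr; [rewrite ler_wpM2l//; lra|lra].
have h2 : L * m a b <= e / 3.
  have h : m a b <= e / 3 / (L + 1).
    apply: (le_trans mle); apply: (@le_trans _ _ dl'); [lra|by rewrite ge_min lexx orbT].
  apply: (le_trans (ler_wpM2l L0 h)); rewrite mulrCA ler_piMr//; first lra.
  by rewrite ler_pdivrMr; lra.
have h3 : \sum_(p <- l) `|phi p.2 - phi p.1| < e / 3.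
  rewrite (big_nth (0,0)) big_mkord; apply: Hdl.
  - by move=> i; have [? ? ?] := hl _ (mem_nth (0,0) (ltn_ord i)).
  - move=> i j ij; have /(pairwiseP (0,0)) pl' := pl.
    have [lij|lij|/val_inj eij] := ltngtP i j.
    + by left; apply: pl' => //; rewrite inE.
    + by right; apply: pl' => //; rewrite inE.
    + by rewrite eij eqxx in ij.
  - rewrite -(big_mkord xpredT (fun i => (nth (0,0) l i).2 - (nth (0,0) l i).1)) -(big_nth (0,0) xpredT (fun p => p.2 - p.1)).
    apply: (le_lt_trans sl); apply: (le_lt_trans mle).
    apply: (@lt_le_trans _ _ dl'); [lra|by rewrite ge_min lexx].
lra.
Qed.
End mean_value.

(** * Increments and their limits *)

Section ultrafilter_limits.
Variables (R : realType) (n : nat).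

(** Along one free ultrafilter every bounded sequence of vectors converges, so a sequence of curves
    converges at all times at once, without extracting subsequences. Containing [\oo] makes eventual
    statements hold along it. *)
Lemma nat_ultrafilter : exists U : set_system nat, UltraFilter U /\ \oo `<=` U.
Proof. exact: ultraFilterLemma. Qed.

Lemma ultra_compact_cvg (T : topologicalType) (I : Type) (U : set_system I) (K : set T)
    (f : I -> T) :
  UltraFilter U -> compact K -> (\forall i \near U, K (f i)) ->
  exists2 p, K p & f @ U --> p.
Proof.
move=> UU cK fK; have [p [Kp clp]] := cK (f @ U) _ fK.
exists p => // A /= nA; have [//|nfA] := in_ultra_setVsetC (f @^-1` A) UU.
by have [z [/= nAz Az]] := clp (~` A) A nfA nA.
Qed.

Lemma ball_compact (c : R) : compact [set x : 'rV[R]_n | `|x| <= c].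
Proof.
apply: bounded_closed_compact.
  by exists c; split; [exact: num_real|move=> M cM x /= /le_trans; apply; exact: ltW].
rewrite (_ : mkset _ = Num.norm @^-1` [set x : R | x <= c])//.
apply: closed_comp; last exact: closed_le.
by move=> x _; exact: norm_continuous.
Qed.

Lemma ultra_bounded_cvg (I : Type) (U : set_system I) (f : I -> 'rV[R]_n) (c : R) :
  UltraFilter U -> (\forall i \near U, `|f i| <= c) -> cvg (f @ U).
Proof.
move=> UU fc; have [p _ fp] := ultra_compact_cvg UU (@ball_compact c) fc.
by apply/cvg_ex; exists p.
Qed.

End ultrafilter_limits.

Section chords.
Variables (R : realType) (n : nat).
Notation V := 'rV[R]_n.
Implicit Types (H : V -> set V) (x y z : V).

Definition tame (H : V -> set V) (k M : R) : Prop :=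
  [/\ 0 <= k, 0 <= M,
      forall x, compact (H x) /\ H x !=set0,
      forall x v w (p q : R), H x v -> H x w -> 0 <= p -> 0 <= q -> p + q = 1 ->
        H x (p *: v + q *: w) &
      (forall x v, H x v -> `|v| <= M) /\
      (forall x y v, H x v -> exists2 w, H y w & `|v - w| <= k * `|x - y|)].

(* [y] is, up to an error [e], within reach of [x] in time [d]: a first-order expansion
   with quadratic remainder.  For [e = 0] this characterises trajectories without any
   derivative, and it passes to pointwise limits. *)
Definition chord (H : V -> set V) (k M d e : R) (x y : V) : Prop :=
  `|y - x| <= M * d + e /\
  exists2 w, H x w & `|y - x - d *: w| <= k * M * d ^+ 2 + e.

Definition curve (H : V -> set V) (k M T : R) (phi : R -> V) : Prop :=
  forall s t, 0 <= s -> s <= t -> t <= T -> chord H k M (t - s) 0 (phi s) (phi t).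

Lemma curve_le H k M T T' phi : T' <= T -> curve H k M T phi -> curve H k M T' phi.
Proof. by move=> TT' c s t s0 st tT; apply: c => //; exact: le_trans TT'. Qed.

Lemma chord_xx H k M x : tame H k M -> chord H k M 0 0 x x.
Proof.
move=> [k0 M0 Hc _ _]; have [_ [w Hw]] := Hc x.
split; first by rewrite subrr normr0 mulr0 addr0.
by exists w => //; rewrite subrr scale0r subr0 normr0 expr0n mulr0 addr0.
Qed.

Lemma chord_step H k M d x w : tame H k M -> 0 <= d -> H x w ->
  chord H k M d 0 x (x + d *: w).
Proof.
move=> [k0 M0 _ _ [Hb _]] d0 Hw; rewrite /chord addrAC subrr add0r; split.
  by rewrite normrZ ger0_norm// mulrC addr0 ler_wpM2r// (Hb x).
by exists w => //; rewrite subrr normr0 addr0 !mulr_ge0// exprn_ge0.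
Qed.

(** The quadratic remainder composes without loss. Over the first piece the base point moves by at
    most [M * d1], so carrying the second velocity back to [x] costs [k * M * d1 * d2], and the
    cross term of [(d1 + d2) ^+ 2] pays twice that. *)
Lemma chord_trans H k M d1 d2 x y z : tame H k M -> 0 <= d1 -> 0 <= d2 ->
  chord H k M d1 0 x y -> chord H k M d2 0 y z -> chord H k M (d1 + d2) 0 x z.
Proof.
move=> tH d10 d20 [l1 [w1 Hw1 e1]] [l2 [w2 Hw2 e2]].
have [k0 M0 _ Hcvx [Hb Hl]] := tH.
rewrite !addr0 in l1 l2 e1 e2.
have zx : z - x = (y - x) + (z - y) by apply/rowP => i; rewrite !mxE; ring.
have lzx : `|z - x| <= M * (d1 + d2).
  by rewrite zx (le_trans (ler_normD _ _))// mulrDr lerD.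
split; first by rewrite addr0.
have [d0|d0] := eqVneq (d1 + d2) 0.
  have [-> ->] : d1 = 0 /\ d2 = 0 by split; lra.
  exists w1 => //; rewrite !addr0 scale0r subr0 (le_trans lzx)// d0 expr0n !mulr0.
  exact: lexx.
have {}d0 : 0 < d1 + d2 by rewrite lt_def d0 addr_ge0.
have [w3 Hw3 e3] := Hl _ x _ Hw2.
exists (d1 / (d1 + d2) *: w1 + d2 / (d1 + d2) *: w3).
  apply: Hcvx => //; [by apply: divr_ge0 => //; exact: ltW..|].
  by rewrite -mulrDl divff// gt_eqF.
rewrite scalerDr !scalerA ![(d1 + d2) * _]mulrC !divfK ?gt_eqF//.
have -> : z - x - (d1 *: w1 + d2 *: w3) =
  (y - x - d1 *: w1) + (z - y - d2 *: w2) + d2 *: (w2 - w3).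
  by apply/rowP => i; rewrite !mxE; ring.
apply: (le_trans (ler_normD _ _)).
have h1 := le_trans (ler_normD (y - x - d1 *: w1) (z - y - d2 *: w2)) (lerD e1 e2).
have h2 : `|d2 *: (w2 - w3)| <= k * M * (d2 * d1).
  rewrite normrZ ger0_norm// (_ : _ * (d2 * d1) = d2 * (k * (M * d1))); last ring.
  by rewrite ler_wpM2l// (le_trans e3)// ler_wpM2l.
have h3 : 0 <= k * M * (d2 * d1) by rewrite !mulr_ge0.
have -> : k * M * (d1 + d2) ^+ 2 = k * M * d1 ^+ 2 + k * M * d2 ^+ 2 + 2 * (k * M * (d2 * d1)) by ring.
lra.
Qed.

(** Grid times match real times only up to the mesh [h]. Reading the duration as [d] costs [M * h]
    in the velocity term, and the rest is the growth of the remainder from [d ^+ 2] to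
    [(d + h) ^+ 2]. *)
Lemma chord_perturb H k M d d' h x y : tame H k M -> 0 <= d -> 0 <= d' -> `|d' - d| <= h ->
  chord H k M d' 0 x y -> chord H k M d (M * h + k * M * (2 * d * h + h ^+ 2)) x y.
Proof.
move=> tH d0 d'0 hd [l1 [w Hw e]]; have [k0 M0 _ _ [Hb _]] := tH.
rewrite !addr0 in l1 e.
have [hd1 hd2] : d - h <= d' /\ d' <= d + h by move: hd; rewrite ler_distl => /andP.
have h0 : 0 <= h by apply: le_trans hd.
have kM : 0 <= k * M by rewrite mulr_ge0.
have q0 : 0 <= k * M * (2 * d * h + h ^+ 2) by rewrite mulr_ge0// addr_ge0 ?exprn_ge0// !mulr_ge0.
split.
  apply: (le_trans l1); apply: (@le_trans _ _ (M * (d + h))); first by rewrite ler_wpM2l.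
  by rewrite mulrDr addrA lerDl.
exists w => //.
have -> : y - x - d *: w = (y - x - d' *: w) + (d' - d) *: w.
  by apply/rowP => i; rewrite !mxE; ring.
apply: (le_trans (ler_normD _ _)).
have h1 : `|(d' - d) *: w| <= M * h.
  by rewrite normrZ mulrC ler_pM// (Hb x).
have h2 : k * M * d' ^+ 2 <= k * M * (d + h) ^+ 2.
  by rewrite ler_wpM2l// lerXn2r// nnegrE// addr_ge0.
have -> : k * M * d ^+ 2 + (M * h + k * M * (2 * d * h + h ^+ 2)) = k * M * (d + h) ^+ 2 + M * h by ring.
lra.
Qed.

Lemma compact_approx (K : set V) (a : V) (d c : R) : compact K ->
  (forall e, 0 < e -> exists2 w, K w & `|a - d *: w| <= c + e) ->
  exists2 w, K w & `|a - d *: w| <= c.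
Proof.
move=> cK H.
have /choice[w Hw] : forall i : nat, exists w, K w /\ `|a - d *: w| <= c + i.+1%:R^-1.
  by move=> i; have [|w ? ?] := H i.+1%:R^-1; [rewrite invr_gt0|exists w].
have [U [UU ooU]] := nat_ultrafilter.
have [p Kp wp] := ultra_compact_cvg UU cK (nearW _ (fun i => (Hw i).1)).
exists p => //; apply/ler_addgt0Pr => e e0; have e20 : 0 < e / 2 by lra.
have [i []] : exists i, `|a - d *: w i| <= c + e / 2 /\ `|p - w i| <= e / 2 / (`|d| + 1).
  apply: (@filter_ex _ U); apply: filterI.
    apply: ooU; near=> i; apply: (le_trans (Hw i).2); rewrite lerD2l ltW//.
    by near: i; exact: (near_infty_natSinv_lt (PosNum e20)).
  apply: cvgr_dist_le => //; rewrite !divr_gt0//; have := normr_ge0 d; lra.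
move=> h1 h2.
have -> : a - d *: p = (a - d *: w i) - d *: (p - w i) by apply/rowP => j; rewrite !mxE; ring.
apply: (le_trans (ler_normB _ _)); rewrite normrZ.
have h3 : `|d| * `|p - w i| <= e / 2.
  apply: (le_trans (ler_wpM2l (normr_ge0 d) h2)); rewrite mulrCA ler_piMr//; first lra.
  by rewrite ler_pdivrMr; have := normr_ge0 d; lra.
lra.
Unshelve. all: by end_near. Qed.

(** The base points [u i] move, so their velocities are carried to [x] by the Lipschitz property;
    compactness of [H x] then removes the last error. *)
Lemma chord_limit H k M d (I : Type) (U : set_system I) (u v : I -> V) x y :
  tame H k M -> ProperFilter U -> 0 <= d -> u @ U --> x -> v @ U --> y ->
  (forall e, 0 < e -> \forall i \near U, chord H k M d e (u i) (v i)) ->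
  chord H k M d 0 x y.
Proof.
move=> tH PU d0 ux vy Huv; have [k0 M0 Hc _ [Hb Hl]] := tH.
have key e : 0 < e -> exists i, [/\ `|x - u i| <= e, `|y - v i| <= e & chord H k M d e (u i) (v i)].
  move=> e0; apply: (@filter_ex _ U).
  have h1 : \forall i \near U, `|x - u i| <= e by apply: cvgr_dist_le.
  have h2 : \forall i \near U, `|y - v i| <= e by apply: cvgr_dist_le.
  have h3 := Huv _ e0.
  by near=> i; split; near: i.
rewrite /chord !addr0; split.
  apply/ler_addgt0Pr => e e0.
  have [|i [h1 h2 [h3 _]]] := key (e / 3); first lra.
  have -> : y - x = (y - v i) + (v i - u i) - (x - u i) by apply/rowP => j; rewrite !mxE; ring.
  have := ler_normB (y - v i + (v i - u i)) (x - u i).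
  have := ler_normD (y - v i) (v i - u i); lra.
apply: compact_approx => [|e e0]; first exact: (Hc x).1.
have dk0 : 0 <= d * k by rewrite mulr_ge0.
(* Three errors (two positions and the remainder) plus [d * k] for the transported velocity add up
   to [e]. *)
have [|i [h1 h2 [_ [w Hw h3]]]] := key (e / (3 + d * k)); first by rewrite divr_gt0//; lra.
have [w' Hw' h4] := Hl _ x _ Hw; exists w' => //.
have -> : y - x - d *: w' = (y - v i) + (v i - u i - d *: w) - (x - u i) + d *: (w - w').
  by apply/rowP => j; rewrite !mxE; ring.
have h5 : `|d *: (w - w')| <= d * k * (e / (3 + d * k)).
  rewrite normrZ ger0_norm// -mulrA ler_wpM2l// (le_trans h4)// ler_wpM2l//.
  by rewrite distrC.
have h6 : d * k * (e / (3 + d * k)) + 3 * (e / (3 + d * k)) = e.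
  by rewrite -mulrDl [d * k + 3]addrC mulrCA divff ?mulr1// gt_eqF//; lra.
have := ler_normD (y - v i + (v i - u i - d *: w) - (x - u i)) (d *: (w - w')).
have := ler_normB (y - v i + (v i - u i - d *: w)) (x - u i).
have := ler_normD (y - v i) (v i - u i - d *: w); lra.
Unshelve. all: by end_near. Qed.

End chords.

(** * Tracking by Euler polygons *)

Section tracking.
Variables (R : realType) (n : nat).
Notation V := 'rV[R]_n.
Variables (H : V -> set V) (k M : R).
Hypothesis tH : tame H k M.

(** Filippov's construction on a grid: each step uses a velocity of [phi] carried over to the node
    of the polygon. A step multiplies the gap by [1 + k * h] and adds [k * M * h ^+ 2]; iterating
    gives the exponential. *)
Lemma euler_polygon (T h : R) (phi : R -> V) (y : V) : 0 < h -> curve H k M T phi ->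
  exists P : nat -> V, [/\ P 0%N = y, forall i, chord H k M h 0 (P i) (P i.+1) &
    forall i, i%:R * h <= T ->
      `|P i - phi (i%:R * h)| <= expR (k * (i%:R * h)) * (`|y - phi 0| + k * M * h * (i%:R * h))].
Proof.
move=> h0 cphi; have [k0 M0 Hc _ [Hb Hl]] := tH.
have sel (i : nat) x : exists w, H x w /\ (i.+1%:R * h <= T ->
    `|phi (i.+1%:R * h) - phi (i%:R * h) - h *: w| <= k * M * h ^+ 2 + h * (k * `|x - phi (i%:R * h)|)).
  (* Past [T] any velocity will do: the polygon never stops, so the tracking curve exists for all
     times. *)
  have [iT|iT] := pselect (i.+1%:R * h <= T); last by have [_ [w]] := Hc x; exists w.
  have [||//|_ [v Hv]] := cphi (i%:R * h) (i.+1%:R * h).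
  - by rewrite mulr_ge0// ltW.
  - by rewrite ler_wpM2r ?ler_nat// ltW.
  rewrite -mulrBl -natrB// subSnn mul1r addr0 => e1.
  have [w Hw e2] := Hl _ x _ Hv; exists w; split => // _.
  have -> : phi (i.+1%:R * h) - phi (i%:R * h) - h *: w =
    (phi (i.+1%:R * h) - phi (i%:R * h) - h *: v) + h *: (v - w).
    by apply/rowP => j; rewrite !mxE; ring.
  apply: (le_trans (ler_normD _ _)); rewrite lerD//.
  rewrite normrZ gtr0_norm// ler_wpM2l//; first exact: ltW.
  by rewrite [X in k * X]distrC.
have /choice[f Hf] : forall p : nat * V, exists w, H p.2 w /\ (p.1.+1%:R * h <= T ->
    `|phi (p.1.+1%:R * h) - phi (p.1%:R * h) - h *: w| <=
       k * M * h ^+ 2 + h * (k * `|p.2 - phi (p.1%:R * h)|)).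
  by move=> [i x]; exact: (sel i x).
pose P := fix P (i : nat) : V := if i is j.+1 then P j + h *: f (j, P j) else y.
exists P; split => //.
  by move=> i; apply: chord_step => //; [exact: ltW|exact: (Hf (i, P i)).1].
have kh : 1 <= 1 + k * h by rewrite lerDl mulr_ge0// ltW.
have c0 : 0 <= k * M * h ^+ 2 by apply: mulr_ge0; [exact: mulr_ge0|exact: sqr_ge0].
have E i : i%:R * h <= T ->
    `|P i - phi (i%:R * h)| <= (1 + k * h) ^+ i * (`|y - phi 0| + i%:R * (k * M * h ^+ 2)).
  elim: i => [_|i IH iT]; first by rewrite !mul0r expr0 mul1r addr0.
  have {}IH := IH (le_trans (ler_wpM2r (ltW h0) (ltac:(by rewrite ler_nat) : i%:R <= i.+1%:R)) iT).
  have e := (Hf (i, P i)).2 iT; rewrite /= in e.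
  have -> : P i.+1 - phi (i.+1%:R * h) = (P i - phi (i%:R * h)) -
     (phi (i.+1%:R * h) - phi (i%:R * h) - h *: f (i, P i)).
    by rewrite /=; apply/rowP => j; rewrite !mxE; ring.
  apply: (le_trans (ler_normB _ _)).
  have h1 : (1 + k * h) * `|P i - phi (i%:R * h)| <=
      (1 + k * h) * ((1 + k * h) ^+ i * (`|y - phi 0| + i%:R * (k * M * h ^+ 2))).
    by rewrite ler_wpM2l//; lra.
  have h2 : k * M * h ^+ 2 <= (1 + k * h) ^+ i.+1 * (k * M * h ^+ 2).
    by rewrite ler_peMl// exprn_ege1.
  have -> : (1 + k * h) ^+ i.+1 * (`|y - phi 0| + i.+1%:R * (k * M * h ^+ 2)) =
     (1 + k * h) * ((1 + k * h) ^+ i * (`|y - phi 0| + i%:R * (k * M * h ^+ 2))) +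
     (1 + k * h) ^+ i.+1 * (k * M * h ^+ 2).
    by rewrite exprS -natr1; ring.
  have h3 : (1 + k * h) * `|P i - phi (i%:R * h)| = `|P i - phi (i%:R * h)| + h * (k * `|P i - phi (i%:R * h)|) by ring.
  lra.
move=> i iT; apply: (le_trans (E i iT)).
rewrite (_ : i%:R * (k * M * h ^+ 2) = k * M * h * (i%:R * h)); last ring.
have i0 : 0 <= i%:R * h by rewrite mulr_ge0// ltW.
apply: ler_wpM2r; first by rewrite addr_ge0// !mulr_ge0// ltW.
rewrite mulrCA expRM_natl lerXn2r ?nnegrE ?expR_ge0 ?expR_ge1Dx//; lra.
Qed.

Lemma polygon_chord (P : nat -> V) (h : R) i j : 0 <= h ->
  (forall i, chord H k M h 0 (P i) (P i.+1)) -> (i <= j)%N ->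
  chord H k M ((j - i)%:R * h) 0 (P i) (P j).
Proof.
move=> h0 HP /subnKC <-; rewrite addKn; elim: (j - i)%N => [|d IH].
  by rewrite mul0r addn0; exact: chord_xx.
rewrite addnS -natr1 mulrDl mul1r; apply: (chord_trans tH _ h0 IH) => //.
by rewrite mulr_ge0.
Qed.

(** Limit of the polygons as the mesh tends to 0. The curve continues beyond [T], and for
    [y = phi 0] it agrees with [phi] on [0, T], so this is also an extension result. *)
Lemma curve_tracking (T : R) (phi : R -> V) (y : V) : curve H k M T phi ->
  exists psi : R -> V, [/\ psi 0 = y, forall T', curve H k M T' psi &
    forall t, 0 <= t -> t <= T -> `|psi t - phi t| <= expR (k * t) * `|y - phi 0|].
Proof.
move=> cphi; have [k0 M0 _ _ _] := tH.
pose h (m : nat) : R := m.+1%:R^-1.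
have h0 m : 0 < h m by rewrite invr_gt0.
have /choice[P HP] := fun m => euler_polygon y (h0 m) cphi.
(* Index of the last node not after [t]: polygons are read as step functions, whose jumps vanish in
   the limit. *)
pose ix (m : nat) (t : R) := Num.truncn (t / h m).
have ixle m t : 0 <= t -> (ix m t)%:R * h m <= t.
  by move=> t0; rewrite -ler_pdivlMr// truncn_le divr_ge0// ltW.
have ixgt m t : 0 <= t -> t - h m < (ix m t)%:R * h m.
  move=> t0; rewrite ltrBlDr -[X in _ + X]mul1r -mulrDl natr1 -ltr_pdivrMr//.
  exact: truncnS_gt.
pose psi_ m t := P m (ix m t).
have [U [UU ooU]] := nat_ultrafilter.
have hU e : 0 < e -> \forall m \near U, h m < e.
  by move=> e0; apply: ooU; exact: (near_infty_natSinv_lt (PosNum e0)).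
have bnd m t : 0 <= t -> `|psi_ m t| <= `|y| + M * t.
  move=> t0; have [P0 Pc _] := HP m.
  have [+ _] := polygon_chord (ltW (h0 m)) Pc (leq0n (ix m t)).
  rewrite P0 addr0 subn0 => l.
  rewrite -[psi_ m t](subrK y) addrC (le_trans (ler_normD _ _))// lerD2l.
  by rewrite (le_trans l)// ler_wpM2l// ixle.
pose psi t := lim (psi_ ^~ t @ U).
have psicvg t : 0 <= t -> psi_ ^~ t @ U --> psi t.
  by move=> t0; apply: ultra_bounded_cvg; apply: nearW => m; exact: bnd.
exists psi; split.
- apply: cvg_lim => //.
  have -> : psi_ ^~ 0 = fun=> y; last exact: cvg_cst.
  by apply/funext => m; rewrite /psi_ /ix mul0r truncn0; case: (HP m).
- move=> T' s t s0 st _; have t0 := le_trans s0 st.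
  apply: (chord_limit tH _ _ (psicvg _ s0) (psicvg _ t0)); first by rewrite subr_ge0.
  (* For a mesh below 1 the error of [chord_perturb] is at most [c] times the mesh. *)
  move=> e e0; pose c := M + k * M * (2 * (t - s) + 1) + 1.
  have kM : 0 <= k * M * (2 * (t - s) + 1) by rewrite !mulr_ge0//; lra.
  have c0 : 0 < c by rewrite /c; lra.
  have he1 := hU 1 ltr01; have he2 := hU (e / c) (divr_gt0 e0 c0).
  near=> m; have [P0 Pc _] := HP m.
  have h1 : h m < 1 by near: m.
  have h2 : h m < e / c by near: m.
  have ij : (ix m s <= ix m t)%N by apply: le_truncn; rewrite ler_wpM2r// invr_ge0 ltW.
  have := polygon_chord (ltW (h0 m)) Pc ij; rewrite natrB// mulrBl => ch.
  have := ixle m s s0; have := ixle m t t0; have := ixgt m s s0; have := ixgt m t t0 => ? ? ? ?.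
  have {ch} [|||c1 [w Hw c2]] := chord_perturb (d := t - s) (h := h m) tH _ _ _ ch.
  + by rewrite subr_ge0.
  + by rewrite -mulrBl mulr_ge0 ?subr_ge0 ?ler_nat// ltW.
  + by rewrite ler_distl; apply/andP; split; lra.
  have le : M * h m + k * M * (2 * (t - s) * h m + h m ^+ 2) <= e.
    have : c * h m <= e by rewrite -ler_pdivlMl// mulrC ltW.
    have : k * M * (2 * (t - s) * h m + h m ^+ 2) <= k * M * (2 * (t - s) + 1) * h m.
      rewrite -[leRHS]mulrA ler_wpM2l//; first exact: mulr_ge0.
      rewrite [leRHS]mulrDl mul1r lerD2l expr2 ler_piMl//; exact: ltW.
    rewrite /c; have := h0 m; lra.
  split; first by apply: (le_trans c1); rewrite lerD2l.
  by exists w => //; apply: (le_trans c2); rewrite lerD2l.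
move=> t t0 tT; apply/ler_addgt0Pr => e e0.
(* [M] pays for the motion of [phi] between the node and [t], the second term for the mesh term of
   the polygon estimate. *)
pose c := M + expR (k * t) * (k * M * t) + 1.
have ek : 0 <= expR (k * t) * (k * M * t) by rewrite !mulr_ge0// expR_ge0.
have c0 : 0 < c by rewrite /c; lra.
have [m [hm1 hm2]] : exists m, h m < e / 2 / c /\ `|psi t - psi_ m t| <= e / 2.
  apply: (@filter_ex _ U); apply: filterI; first by apply: hU; rewrite !divr_gt0.
  by apply: cvgr_dist_le; [exact: psicvg|lra].
have [_ _ tr] := HP m; have {tr} := tr (ix m t) (le_trans (ixle m t t0) tT).
set tm := (ix m t)%:R * h m => tr.
have tm0 : 0 <= tm by rewrite mulr_ge0// ltW.
have tmt : tm <= t by exact: ixle.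
have ttm : t - tm < h m by have := ixgt m t t0; rewrite -/tm; lra.
have [cm _] := cphi tm t tm0 tmt tT.
have h1 : M * (t - tm) <= M * h m by rewrite ler_wpM2l// ltW.
have h2 : expR (k * tm) * (`|y - phi 0| + k * M * h m * tm) <=
          expR (k * t) * `|y - phi 0| + expR (k * t) * (k * M * t) * h m.
  have -> : expR (k * t) * `|y - phi 0| + expR (k * t) * (k * M * t) * h m =
    expR (k * t) * (`|y - phi 0| + k * M * t * h m) by ring.
  apply: ler_pM => //; rewrite ?expR_ge0//.
  - by rewrite addr_ge0// !mulr_ge0// ltW.
  - by rewrite ler_expR ler_wpM2l.
  - rewrite lerD2l mulrAC; apply: ler_wpM2r; first exact: ltW.
    by apply: ler_wpM2l => //; exact: mulr_ge0.
have h3 : c * h m <= e / 2 by rewrite -ler_pdivlMl// mulrC ltW.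
have -> : psi t - phi t = (psi t - psi_ m t) + (psi_ m t - phi tm) - (phi t - phi tm).
  by apply/rowP => j; rewrite !mxE; ring.
have := ler_normB (psi t - psi_ m t + (psi_ m t - phi tm)) (phi t - phi tm).
have := ler_normD (psi t - psi_ m t) (psi_ m t - phi tm).
have := h0 m; rewrite /psi_ in hm2 *; rewrite /c in h3; lra.
Unshelve. all: by end_near. Qed.

End tracking.

(** * Truncation of the right-hand side *)

Section truncation.
Variables (R : realType) (n : nat).
Notation V := 'rV[R]_n.
Implicit Types (x y : V) (G : V -> set V).

Lemma rV_norm_le x (c : R) : 0 <= c -> (forall j, `|x ord0 j| <= c) -> `|x| <= c.
Proof.
move=> c0 H; rewrite [leLHS]/Num.norm /= mx_normrE; apply/bigmax_leP; split => //= -[i j] _ /=.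
by rewrite ord1.
Qed.

Lemma rV_coord_le x j : `|x ord0 j| <= `|x|.
Proof.
rewrite [leRHS]/Num.norm /= mx_normrE; apply/bigmax_geP; right => /=.
by exists (ord0, j).
Qed.

(** Coordinatewise because the norm of a row vector is its largest coordinate: for [0 <= r] this is
    a retraction onto the closed ball that does not increase distances. *)
Definition clamp (r : R) (x : V) : V := \row_j Num.max (- r) (Num.min r (x ord0 j)).

Lemma clamp1_lip (lo hi a b : R) : b <= a ->
  Num.max lo (Num.min hi b) <= Num.max lo (Num.min hi a) /\
  Num.max lo (Num.min hi a) <= Num.max lo (Num.min hi b) + (a - b).
Proof.
move=> ab; split; first by rewrite ge_max le_max lexx /= le_max le_min !ge_min lexx ab !orbT.
rewrite ge_max; apply/andP; split.
  apply: (@le_trans _ _ (Num.max lo (Num.min hi b))); first by rewrite le_max lexx.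
  by rewrite lerDl subr_ge0.
have h : Num.min hi a <= Num.min hi b + (a - b).
  by rewrite -lerBlDr le_min; apply/andP; split; rewrite lerBlDr ge_min; apply/orP; [left|right]; lra.
by apply: (le_trans h); rewrite lerD2r le_max lexx orbT.
Qed.

Lemma norm_clamp r x : 0 <= r -> `|clamp r x| <= r.
Proof.
move=> r0; apply: rV_norm_le => // j; rewrite mxE ler_norml le_max lexx /=.
by rewrite ge_max ge_min lexx andbT; lra.
Qed.

Lemma clamp_id r x : `|x| <= r -> clamp r x = x.
Proof.
move=> xr; apply/rowP => j; rewrite mxE.
have := le_trans (rV_coord_le x j) xr; rewrite ler_norml => /andP[h1 h2].
by rewrite min_r// max_r.
Qed.

Lemma clamp_lip r x y : `|clamp r x - clamp r y| <= `|x - y|.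
Proof.
apply: rV_norm_le => // j; rewrite !mxE; apply: le_trans (rV_coord_le (x - y) j).
rewrite !mxE; move: (x ord0 j) (y ord0 j) => a b.
wlog ab : a b / b <= a.
  by move=> H; have [/H//|/ltW/H] := leP b a; rewrite distrC [X in _ <= X -> _]distrC.
have [h1 h2] := clamp1_lip (- r) r ab.
by rewrite !ger0_norm ?subr_ge0// lerBlDl.
Qed.

Definition regular G : Prop :=
  [/\ sv_loc_lipschitz G, forall x, compact (G x) /\ G x !=set0 &
      forall x v w (p q : R), G x v -> G x w -> 0 <= p -> 0 <= q -> p + q = 1 ->
        G x (p *: v + q *: w)].

(** Retracting the argument, rather than cutting off the values, keeps the values compact and
    convex. *)
Definition trunc G (r : R) : V -> set V := fun x => G (clamp r x).

Lemma compact_norm_bounded (K : set V) : compact K -> exists2 c : R, 0 <= c & forall x, K x -> `|x| <= c.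
Proof.
move=> /compact_bounded [c [_ H]]; exists (`|c| + 1); first by rewrite addr_ge0.
by move=> x /H; apply; have := ler_norm c; lra.
Qed.

Lemma tame_trunc G r : regular G -> 0 <= r -> exists k M, tame (trunc G r) k M.
Proof.
move=> [lip cpt cvx] r0.
have [k k0 Hk] := lip _ (@ball_compact R n r).
have [c c0 Hc] := compact_norm_bounded (cpt 0).1.
(* [c] bounds the values at 0, and [k * r] their variation over the ball. *)
exists k, (c + k * r); split => //.
- exact: ltW.
- by rewrite addr_ge0// mulr_ge0// ltW.
- by move=> x; exact: cpt.
- by move=> x; exact: cvx.
split.
  move=> x v Gv; have [||w [Gw vw]] := Hk (clamp r x) 0 _ _ v Gv.
  - exact: norm_clamp.
  - by rewrite /= normr0.
  rewrite subr0 in vw.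
  have h1 : k * `|clamp r x| <= k * r by rewrite ler_wpM2l ?norm_clamp// ltW.
  have := Hc _ Gw; have := ler_normD (v - w) w; rewrite subrK; lra.
move=> x y v Gv; have [||w [Gw vw]] := Hk (clamp r x) (clamp r y) _ _ v Gv.
- exact: norm_clamp.
- exact: norm_clamp.
exists w => //; apply: (le_trans vw); apply: ler_wpM2l; [exact: ltW|exact: clamp_lip].
Qed.

Definition oppF G : V -> set V := fun x => [set v | G x (- v)].

Lemma oppFK G : oppF (oppF G) = G.
Proof. by apply/funext => x; apply/seteqP; split => v; rewrite /oppF /= opprK. Qed.

Lemma oppFE G x : oppF G x = -%R @` G x.
Proof.
apply/seteqP; split => [v Gv|_ [v Gv <-]]; last by rewrite /oppF /= opprK.
by exists (- v) => //; rewrite opprK.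
Qed.

Lemma compact_opp (K : set V) : compact K -> compact (-%R @` K).
Proof.
move=> cK; apply: continuous_compact => //; apply: continuous_subspaceT.
by move=> x; exact: opp_continuous.
Qed.

Lemma regular_opp G : regular G -> regular (oppF G).
Proof.
move=> [lip cpt cvx]; split.
- move=> K /lip[k k0 Hk]; exists k => // x1 x2 Kx1 Kx2 y Gy.
  have [z [Gz yz]] := Hk _ _ Kx1 Kx2 _ Gy; exists (- z); split; first by rewrite /oppF /= opprK.
  by rewrite opprK -normrN opprD.
- move=> x; rewrite oppFE; have [cG [v Gv]] := cpt x; split; first exact: compact_opp.
  by exists (- v); exists v.
move=> x v w p q Gv Gw p0 q0 pq; rewrite /oppF /= opprD -!scalerN; exact: cvx.
Qed.

Lemma tame_opp G k M : tame G k M -> tame (oppF G) k M.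
Proof.
move=> [k0 M0 cpt cvx [Hb Hl]]; split => //.
- move=> x; rewrite oppFE; have [cG [v Gv]] := cpt x; split; first exact: compact_opp.
  by exists (- v); exists v.
- move=> x v w p q Gv Gw p0 q0 pq; rewrite /oppF /= opprD -!scalerN; exact: cvx.
split=> [x v Gv|x y v Gv]; first by rewrite -normrN (Hb x).
have [w Gw vw] := Hl _ y _ Gv; exists (- w); first by rewrite /oppF /= opprK.
by rewrite opprK -normrN opprD.
Qed.

End truncation.

(** * Trajectories *)

Section trajectories.
Variables (R : realType) (n : nat).
Notation V := 'rV[R]_n.
Notation mu := (@lebesgue_measure R).
Implicit Types (G : V -> set V) (phi : R -> V).

Definition traj (W : normedModType R) (G : W -> set W) (T : R) (phi : R -> W) : Prop :=
  abs_cont_on 0 T phi /\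
  exists N : set R, mu.-negligible N /\
    forall t, 0 <= t -> t <= T -> ~ N t -> derivable phi t 1 /\ G (phi t) ('D_1 phi t).

Lemma abs_cont_sub (W : normedModType R) (a b s t : R) (phi : R -> W) :
  a <= s -> t <= b -> abs_cont_on a b phi -> abs_cont_on s t phi.
Proof.
move=> as_ tb ac e e0; have [d d0 H] := ac e e0; exists d => // k u v h1; apply: H.
by move=> i; have [? [? ?]] := h1 i; split; [exact: le_trans as_ _|split => //; exact: le_trans tb].
Qed.

Lemma lipschitz_abs_cont (W : normedModType R) (a b M : R) (phi : R -> W) : 0 <= M ->
  (forall s t, a <= s -> s <= t -> t <= b -> `|phi t - phi s| <= M * (t - s)) ->
  abs_cont_on a b phi.
Proof.
move=> M0 lip e e0; exists (e / (M + 1)); first by rewrite divr_gt0//; lra.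
move=> k u v h1 _ hs.
apply: (@le_lt_trans _ _ (\sum_(i < k) M * (v i - u i))).
  by apply: ler_sum => i _; have [? [? ?]] := h1 i; exact: lip.
rewrite -mulr_sumr; move: hs; rewrite ltr_pdivlMr; last lra.
have : 0 <= \sum_(i < k) (v i - u i).
  by apply: sumr_ge0 => i _; have [? [? ?]] := h1 i; rewrite subr_ge0.
move: (\sum_(i < k) _) => S S0; rewrite mulrDr mulr1 mulrC; lra.
Qed.

Lemma solution_domainP (D : set R) t : is_sol_domain D -> D t ->
  0 <= t /\ forall s, 0 <= s -> s <= t -> D s.
Proof.
move=> [[T [T0 ->]]|[T [T0 ->]]] /=.
  by rewrite in_itv/= => /andP[t0 tT]; split => // s s0 st; rewrite in_itv/= s0 (le_trans st).
by move=> [t0 tT]; split => // s s0 st; split => //; apply: le_lt_trans tT; rewrite lee_fin.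
Qed.

Lemma solution_traj (W : normedModType R) (G : W -> set W) (x0 : W) (D : set R) (phi : R -> W) (t : R) :
  is_solution G x0 D phi -> D t -> traj G t phi.
Proof.
move=> [dD _ ac [N [negN HN]]] Dt; have [t0 Ds] := solution_domainP dD Dt; split.
  by apply: ac => // s /=; rewrite in_itv/= => /andP[? ?]; exact: Ds.
by exists N; split => // s s0 st; apply: HN; exact: Ds.
Qed.

Lemma traj_solution (W : normedModType R) (G : W -> set W) (T : R) (phi : R -> W) : 0 <= T -> traj G T phi ->
  is_solution G (phi 0) `[0, T]%classic phi.
Proof.
move=> T0 [ac [N [negN HN]]]; split => //; first by left; exists T.
  move=> a b ab abT; apply: abs_cont_sub ac.
    by have /abT := (ltac:(by rewrite /= in_itv/= lexx) : `[a, b]%classic a); rewrite /= in_itv/= => /andP[].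
  by have /abT := (ltac:(by rewrite /= in_itv/= lexx andbT) : `[a, b]%classic b); rewrite /= in_itv/= => /andP[].
by exists N; split => // t; rewrite /= in_itv/= => /andP[? ?]; exact: HN.
Qed.

Lemma traj_le (W : normedModType R) (G : W -> set W) (T T' : R) (phi : R -> W) :
  T' <= T -> traj G T phi -> traj G T' phi.
Proof.
move=> TT' [ac [N [negN HN]]]; split; first exact: abs_cont_sub ac.
by exists N; split => // t t0 tT; apply: HN => //; exact: le_trans TT'.
Qed.

Lemma abs_cont_bounded (W : normedModType R) (T : R) (phi : R -> W) :
  abs_cont_on 0 T phi -> exists2 r : R, 0 <= r & forall t, 0 <= t -> t <= T -> `|phi t| <= r.
Proof.
move=> ac; have [T0|T0] := leP 0 T; last by exists 0 => // t t0 tT; lra.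
have [d d0 Hd] := ac 1 ltr01.
have Hd' s t : 0 <= s -> s <= t -> t <= T -> t - s < d -> `|phi t - phi s| < 1.
  move=> s0 st tT tsd; have := Hd 1%N (fun=> s) (fun=> t).
  rewrite !big_ord_recl !big_ord0 !addr0; apply => //.
  by move=> i j; rewrite !ord1 eqxx.
have [r Hr] : exists r, forall u, 0 <= u -> u <= T -> `|phi u| <= r.
  apply: (@cousin _ 0 T (fun s t => exists r, forall u, s <= u -> u <= t -> `|phi u| <= r)) => //.
    move=> s t u s0 st tu uT [r1 H1] [r2 H2]; exists (Num.max r1 r2) => v sv vu.
    by rewrite le_max; case: (leP v t) => vt; [rewrite H1|rewrite H2 ?orbT// ltW].
  move=> x x0 xT; exists d => // s t s0 sx xt tT xs tx.
  exists (`|phi x| + 1) => u su ut.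
  have : `|phi u - phi x| < 1.
    by have [ux|xu] := leP x u; [apply: Hd'; lra|rewrite distrC; apply: Hd'; lra].
  have := ler_normD (phi u - phi x) (phi x); rewrite subrK; lra.
by exists r => //; apply: le_trans (Hr 0 _ _).
Qed.

Lemma convex_thickening (K : set V) (rho : R) v w (p q : R) :
  (forall v w (p q : R), K v -> K w -> 0 <= p -> 0 <= q -> p + q = 1 -> K (p *: v + q *: w)) ->
  (exists2 z, K z & `|v - z| <= rho) -> (exists2 z, K z & `|w - z| <= rho) ->
  0 <= p -> 0 <= q -> p + q = 1 -> exists2 z, K z & `|p *: v + q *: w - z| <= rho.
Proof.
move=> cvx [z1 K1 h1] [z2 K2 h2] p0 q0 pq; exists (p *: z1 + q *: z2); first exact: cvx.
have -> : p *: v + q *: w - (p *: z1 + q *: z2) = p *: (v - z1) + q *: (w - z2).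
  by apply/rowP => j; rewrite !mxE; ring.
apply: (le_trans (ler_normD _ _)); rewrite !normrZ !ger0_norm//.
have e1 : p * `|v - z1| <= p * rho by rewrite ler_wpM2l.
have e2 : q * `|w - z2| <= q * rho by rewrite ler_wpM2l.
have e3 : p * rho + q * rho = rho by rewrite -mulrDl pq mul1r.
lra.
Qed.

(* The expansion may be based at any time [o] of the interval, hence also serves the
   time-reversed trajectory. *)
Lemma traj_chord G k M r T phi : tame (trunc G r) k M -> traj G T phi ->
  (forall t, 0 <= t -> t <= T -> `|phi t| <= r) ->
  forall s t, 0 <= s -> s <= t -> t <= T -> `|phi t - phi s| <= M * (t - s) /\
    forall o, s <= o -> o <= t ->
      exists2 w, G (phi o) w & `|phi t - phi s - (t - s) *: w| <= k * M * (t - s) ^+ 2.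
Proof.
move=> tG [ac [N [negN HN]]] br; have [k0 M0 Hc cvx [Hb Hl]] := tG.
have GE t : 0 <= t -> t <= T -> trunc G r (phi t) = G (phi t).
  by move=> t0 tT; rewrite /trunc clamp_id// br.
have lip s t : 0 <= s -> s <= t -> t <= T -> `|phi t - phi s| <= M * (t - s).
  move=> s0 st tT; apply/ler_addgt0Pr => e e0.
  have [|||||w /= Mw Hw] := @abs_cont_mean_value R V s t phi [set v | `|v| <= M] M N st _ negN _ _ _ _ e e0.
  - exact: abs_cont_sub ac.
  - by exists 0; rewrite /= normr0.
  - move=> x y p q /= hx hy p0 q0 pq; apply: (le_trans (ler_normD _ _)).
    rewrite !normrZ !ger0_norm//.
    have e1 : p * `|x| <= p * M by rewrite ler_wpM2l.
    have e2 : q * `|y| <= q * M by rewrite ler_wpM2l.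
    have e3 : p * M + q * M = M by rewrite -mulrDl pq mul1r.
    lra.
  - by [].
  - move=> u su ut Nu; have [||du Gu] := HN u _ _ Nu; [lra|lra|].
    split => //; apply: (Hb (phi u)); rewrite GE//; lra.
  have := ler_normD (phi t - phi s - (t - s) *: w) ((t - s) *: w).
  rewrite subrK normrZ ger0_norm ?subr_ge0//.
  have : (t - s) * `|w| <= M * (t - s) by rewrite mulrC ler_wpM2r// subr_ge0.
  lra.
move=> s t s0 st tT; split => [|o so ot]; first exact: lip.
have o0 := le_trans s0 so; have oT := le_trans ot tT.
have dst : 0 <= t - s by rewrite subr_ge0.
have kM : 0 <= k * M * (t - s) by rewrite !mulr_ge0.
apply: compact_approx => [|e e0]; first by rewrite -GE//; exact: (Hc _).1.
(* By the Lipschitz property and the speed bound, almost all velocities on [s, t] lie in this convex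
   thickening of [G (phi o)], hence so does a mean velocity. *)
pose C : set V := [set v | exists2 z, G (phi o) z & `|v - z| <= k * M * (t - s)].
have [|||||v [z Gz vz] Hv] := @abs_cont_mean_value R V s t phi C (M + k * M * (t - s)) N st _ negN _ _ _ _ e e0.
- exact: abs_cont_sub ac.
- have [_ [z]] := Hc (phi o); rewrite GE// => Gz.
  by exists z; exists z => //; rewrite subrr normr0.
- move=> x y p q Cx Cy; apply: convex_thickening => //.
  by rewrite -GE//; exact: cvx.
- move=> w [z Gz wz]; have : `|z| <= M by apply: (Hb (phi o)); rewrite GE.
  by have := ler_normD (w - z) z; rewrite subrK; lra.
- move=> u su ut Nu; have [u0 uT] : 0 <= u /\ u <= T by lra.
  have [du Gu] := HN u u0 uT Nu; split => //.
  rewrite -GE// in Gu.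
  have [z Gz h] := Hl _ (phi o) _ Gu; rewrite GE// in Gz; exists z => //.
  apply: (le_trans h); rewrite -mulrA ler_wpM2l//.
  have [ou|uo] := leP o u.
    by apply: (le_trans (lip _ _ o0 ou uT)); rewrite ler_wpM2l//; lra.
  rewrite distrC; apply: (le_trans (lip _ _ u0 (ltW uo) oT)); rewrite ler_wpM2l//; lra.
exists z => //.
have -> : phi t - phi s - (t - s) *: z = (phi t - phi s - (t - s) *: v) + (t - s) *: (v - z).
  by apply/rowP => j; rewrite !mxE; ring.
apply: (le_trans (ler_normD _ _)); rewrite normrZ ger0_norm//.
have : (t - s) * `|v - z| <= (t - s) * (k * M * (t - s)) by rewrite ler_wpM2l.
have -> : k * M * (t - s) ^+ 2 = (t - s) * (k * M * (t - s)) by ring.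
lra.
Qed.

Lemma traj_curve G k M r T phi : tame (trunc G r) k M -> traj G T phi ->
  (forall t, 0 <= t -> t <= T -> `|phi t| <= r) -> curve (trunc G r) k M T phi.
Proof.
move=> tG tphi br s t s0 st tT.
have [l H] := traj_chord tG tphi br s0 st tT.
split; first by rewrite addr0.
have [w Gw h] := H s (lexx _) st; exists w; last by rewrite addr0.
by rewrite /trunc clamp_id// br//; lra.
Qed.

Lemma lipschitz_rV_ae_derivable (phi : R -> V) (M T : R) : 0 <= M ->
  (forall s t, 0 <= s -> s <= t -> t <= T -> `|phi t - phi s| <= M * (t - s)) ->
  exists N : set R, mu.-negligible N /\ forall t, 0 < t -> t < T -> ~ N t -> derivable phi t 1.
Proof.
move=> M0 lip.
have [T0|T0] := leP T 0.
  exists set0; split; first exact: negligible_set0.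
  by move=> t t0 tT; have := lt_trans t0 tT; rewrite ltNge T0.
(* Freezing time outside [0, T] gives a curve that is Lipschitz on the whole line and equals [phi]
   near interior times. *)
pose c (t : R) := Num.max 0 (Num.min T t).
have cE t : 0 <= t -> t <= T -> c t = t.
  by move=> t0 tT; rewrite /c min_r// max_r.
have c01 t : 0 <= c t /\ c t <= T.
  by rewrite /c le_max lexx /= ge_max ge_min lexx /=; split => //; lra.
have clip s t : s <= t -> c s <= c t /\ c t - c s <= t - s.
  by move=> st; have [h1 h2] := clamp1_lip 0 T st; rewrite -/(c s) -/(c t) in h1 h2; split => //; lra.
have liphi j s t : `|phi (c s) ord0 j - phi (c t) ord0 j| <= M * `|s - t|.
  wlog st : s t / t <= s.
    by move=> H; have [|/ltW] := leP t s; [exact: H|rewrite distrC [X in M * X]distrC; exact: H].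
  have [h1 h2] := clip _ _ st.
  have [? ?] := c01 s; have [? ?] := c01 t.
  have := rV_coord_le (phi (c s) - phi (c t)) j; rewrite !mxE => /le_trans; apply.
  apply: (le_trans (lip _ _ _ _ _)) => //.
  by rewrite ler_wpM2l// ger0_norm ?subr_ge0.
have ae j := @lipschitz_ae_derivable R (fun t => phi (c t) ord0 j) M 0 T (liphi j).
exists (\big[setU/set0]_(j < n) ~` [set x | 0 < x < T -> derivable (fun t => phi (c t) ord0 j) x 1]).
split.
  by elim/big_ind : _ => [|A B|j _]; [exact: negligible_set0|exact: negligibleU|exact: ae].
move=> t t0 tT; rewrite -bigcup_seq => NN.
apply/derivable_mxP => i j; rewrite ord1.
have : derivable (fun t => phi (c t) ord0 j) t 1.
  apply: contrapT => nd; apply: NN; exists j => /=; first by rewrite mem_index_enum.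
  by move=> H; apply: nd; apply: H; rewrite t0.
apply: near_eq_derivable; near=> u.
by rewrite cE//; apply: ltW; near: u; [exact: lt_nbhsr|exact: lt_nbhsl].
Unshelve. all: by end_near. Qed.

(** Divided by its length [h], a chord from [phi t] says that the difference quotient is within
    [k * M * h] of the closed set [G (phi t)], which therefore contains the derivative where it
    exists. *)
Lemma curve_traj G k M r T phi : tame (trunc G r) k M -> curve (trunc G r) k M T phi ->
  (forall t, 0 <= t -> t <= T -> `|phi t| <= r) -> traj G T phi.
Proof.
move=> tG cphi br; have [k0 M0 Hc _ _] := tG.
have lip s t : 0 <= s -> s <= t -> t <= T -> `|phi t - phi s| <= M * (t - s).
  by move=> s0 st tT; have [+ _] := cphi s t s0 st tT; rewrite addr0.
split; first exact: lipschitz_abs_cont lip.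
have [N [negN HN]] := lipschitz_rV_ae_derivable M0 lip.
(* The endpoints are discarded because [derivable] is two-sided and [phi] is arbitrary outside
   [0, T]. *)
exists (N `|` [set 0] `|` [set T]); split.
  by apply: negligibleU; [apply: negligibleU => //|];
    (apply/negligibleP; [exact: measurable_set1|exact: lebesgue_measure_set1]).
move=> t t0 tT /not_orP[/not_orP[Nt /eqP tn0] /eqP tnT].
have {}t0 : 0 < t by rewrite lt_def tn0.
have {}tT : t < T by rewrite lt_neqAle tnT.
have dphi := HN _ t0 tT Nt; split => //.
have [w Gw] : exists2 w, G (phi t) w & `|'D_1 phi t - 1 *: w| <= 0.
  have GE : trunc G r (phi t) = G (phi t) by rewrite /trunc clamp_id// br// ltW.
  apply: compact_approx => [|e e0]; first by rewrite -GE; exact: (Hc _).1.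
  have [|d d0 Hd] := derivable_linear_approx dphi (_ : 0 < e / 2); first lra.
  have kM : 0 <= k * M by rewrite mulr_ge0.
  pose h := Num.min (d / 2) (Num.min (T - t) (e / 2 / (k * M + 1))).
  have h0 : 0 < h by rewrite /h !lt_min !divr_gt0//= ?andbT ?subr_gt0 ?tT//; lra.
  have hd : h < d by rewrite gt_min; apply/orP; left; lra.
  have hT : t + h <= T by rewrite -lerBrDl !ge_min lexx /= orbT.
  have hk : k * M * h <= e / 2.
    have : h <= e / 2 / (k * M + 1) by rewrite !ge_min lexx /= !orbT.
    rewrite ler_pdivlMr; last lra.
    by rewrite mulrDr mulr1 mulrC; lra.
  have [_ [w Gw Hw]] := cphi t (t + h) (ltW t0) ltac:(by rewrite lerDl ltW) hT.
  rewrite GE in Gw; exists w => //; rewrite scale1r add0r.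
  have := Hd (t + h); rewrite (_ : t + h - t = h) in Hw *; last by ring.
  rewrite gtr0_norm// => /(_ hd) H1.
  have H2 : h * `|'D_1 phi t - w| <= e * h.
    have -> : h * `|'D_1 phi t - w| = `|h *: ('D_1 phi t - w)| by rewrite normrZ gtr0_norm.
    have -> : h *: ('D_1 phi t - w) = (phi (t + h) - phi t - h *: w) - (phi (t + h) - phi t - h *: 'D_1 phi t).
      by apply/rowP => j; rewrite !mxE; ring.
    apply: (le_trans (ler_normB _ _)).
    have : k * M * h ^+ 2 <= e / 2 * h by rewrite expr2 mulrA ler_wpM2r// ltW.
    lra.
  by rewrite -(ler_pM2l h0) [h * e]mulrC.
by rewrite normr_le0 scale1r subr_eq0 => /eqP ->.
Qed.

Lemma traj_bounded G T phi : traj G T phi ->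
  exists2 r : R, 0 <= r & forall t, 0 <= t -> t <= T -> `|phi t| <= r.
Proof. by move=> [ac _]; exact: abs_cont_bounded. Qed.

(** A reversed increment starts where the original one ended, so the expansion is taken with base
    point [o] at the right end of the original interval. *)
Lemma traj_reverse G T phi : regular G -> traj G T phi -> traj (oppF G) T (fun t => phi (T - t)).
Proof.
move=> rG tphi; have [r r0 br] := traj_bounded tphi.
have [k [M tG]] := tame_trunc rG r0.
apply: (@curve_traj (oppF G) k M r); first exact: (tame_opp tG).
  move=> s t s0 st tT; have [||| l H] := traj_chord tG tphi br (s := T - t) (t := T - s); [lra..|].
  have [||w Gw h] := H (T - s); [lra..|].
  have e : T - s - (T - t) = t - s by ring.
  rewrite e in l h; split; first by rewrite addr0 distrC.
  exists (- w).
    by rewrite /trunc clamp_id ?br// ?opprK /oppF /= ?opprK//; lra.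
  rewrite addr0 -normrN; congr (_ <= _): h; congr (`|_|).
  by apply/rowP => j; rewrite !mxE; ring.
by move=> t t0 tT; apply: br; lra.
Qed.

Lemma traj_shift G T a phi : regular G -> 0 <= a -> traj G T phi ->
  traj G (T - a) (fun t => phi (a + t)).
Proof.
move=> rG a0 tphi; have [r r0 br] := traj_bounded tphi.
have [k [M tG]] := tame_trunc rG r0.
apply: (@curve_traj _ k M r) => //; last by move=> t t0 tT; apply: br; lra.
move=> s t s0 st tT; have := traj_curve tG tphi br (s := a + s) (t := a + t).
by rewrite (_ : a + t - (a + s) = t - s); [apply; lra|ring].
Qed.

(** Increments across the junction come from [chord_trans], so no derivative is examined there. *)
Lemma traj_concat G T1 T2 phi1 phi2 : regular G -> 0 <= T1 -> 0 <= T2 ->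
  traj G T1 phi1 -> traj G T2 phi2 -> phi2 0 = phi1 T1 ->
  traj G (T1 + T2) (fun t => if t <= T1 then phi1 t else phi2 (t - T1)).
Proof.
move=> rG T10 T20 t1 t2 e.
have [r1 r10 br1] := traj_bounded t1; have [r2 r20 br2] := traj_bounded t2.
pose r := Num.max r1 r2.
have r0 : 0 <= r by rewrite le_max r10.
have {}br1 t : 0 <= t -> t <= T1 -> `|phi1 t| <= r by move=> *; rewrite le_max br1.
have {}br2 t : 0 <= t -> t <= T2 -> `|phi2 t| <= r by move=> *; rewrite le_max br2 ?orbT.
have [k [M tG]] := tame_trunc rG r0.
have c1 := traj_curve tG t1 br1; have c2 := traj_curve tG t2 br2.
apply: (@curve_traj _ k M r) => //; last first.
  by move=> t t0 tT; case: (leP t T1) => tT1; [apply: br1|apply: br2; lra].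
move=> s t s0 st tT; case: (leP t T1) => tT1; case: (leP s T1) => sT1.
- exact: c1.
- by exfalso; lra.
- have -> : t - s = (T1 - s) + (t - T1) by ring.
  apply: (@chord_trans _ _ _ _ _ _ _ _ (phi1 T1)) => //; rewrite ?subr_ge0//; first exact: ltW.
    exact: c1.
  rewrite -e; have := c2 0 (t - T1); rewrite subr0; apply => //; lra.
- have := c2 (s - T1) (t - T1).
  by rewrite (_ : t - T1 - (s - T1) = t - s); [apply; lra|ring].
Qed.

End trajectories.

(** * Bounds on reachable sets *)

Section bounded_reachability.
Variables (R : realType) (n : nat).
Notation V := 'rV[R]_n.
Notation mu := (@lebesgue_measure R).
Variable G : V -> set V.
Hypothesis rG : regular G.
Implicit Types (phi : R -> V).

Lemma traj0 phi : traj G 0 phi.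
Proof.
have [k [M tG]] := tame_trunc rG (normr_ge0 (phi 0)).
apply: (curve_traj tG) => [s t s0 st t0|t t0 t0'].
  have -> : s = 0 by lra.
  have -> : t = 0 by lra.
  by rewrite subrr; exact: chord_xx.
by have -> : t = 0 by lra.
Qed.

(** [M] bounds the speed on the ball of radius [r + 1] and depends on [r] only: the unit gap cannot
    be crossed while [M * T < 1]. This delay, common to all trajectories, lets a whole family be
    prolonged. *)
Lemma traj_escape (r : R) : 0 <= r -> exists2 M, 0 <= M &
  forall T phi, 0 <= T -> traj G T phi -> `|phi 0| <= r -> M * T < 1 -> `|phi T| <= r + 1.
Proof.
move=> r0; have r10 : 0 <= r + 1 by lra.
have [k [M tG]] := tame_trunc rG r10; have [_ M0 _ _ _] := tG.
exists M => // T phi T0 tphi phi0 MT.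
(* A cruder speed bound [M'], valid along this [phi], serves only to choose the step of the
   continuation. *)
have [r' r'0 br'] := traj_bounded tphi.
have [k' [M' tG']] := tame_trunc rG r'0; have [_ M'0 _ _ _] := tG'.
suff H : (forall v, 0 <= v -> v <= 0 -> `|phi v| <= r + 1) ->
         (forall v, 0 <= v -> v <= T -> `|phi v| <= r + 1).
  apply: H => // v v0 v0'; have -> : v = 0 by lra.
  lra.
apply: (@cousin _ 0 T (fun s u => (forall v, 0 <= v -> v <= s -> `|phi v| <= r + 1) ->
         (forall v, 0 <= v -> v <= u -> `|phi v| <= r + 1))) => //.
  by move=> s t u _ _ _ _ h1 h2 /h1.
(* A displacement at speed [M'] during [2 * d] stays within the margin [1 - M * T] left in the unit
   gap. *)
move=> x x0 xT; pose d := (1 - M * T) / (2 * (M' + 1)).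
have d0 : 0 < d by rewrite divr_gt0//; lra.
exists d => // s u s0 sx xu uT xs ux Hs v v0 vu.
have [vs|sv] := leP v s; first exact: Hs.
have sT : s <= T := le_trans sx xT.
have [l1 _] := traj_chord tG (traj_le sT tphi) Hs (lexx 0) s0 (lexx s).
have [||| l2 _] := traj_chord tG' tphi br' (s := s) (t := v); [lra..|].
have h1 : M * (s - 0) <= M * T by rewrite subr0 ler_wpM2l.
have h2 : M' * (v - s) <= 1 - M * T.
  apply: (@le_trans _ _ (M' * (2 * d))); first by rewrite ler_wpM2l//; lra.
  have -> : M' * (2 * d) = (1 - M * T) * (M' / (M' + 1)).
    by rewrite /d; field; rewrite gt_eqF//; lra.
  by rewrite ler_piMr; [|lra|rewrite ler_pdivrMr; lra].
have := ler_normD (phi v - phi s) (phi s - phi 0 + phi 0).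
have := ler_normD (phi s - phi 0) (phi 0).
by rewrite !subrK; lra.
Qed.

Definition reach_bound (rho T r : R) : Prop :=
  forall phi tau, 0 <= tau -> tau <= T -> traj G tau phi -> `|phi 0| <= rho -> `|phi tau| <= r.

Lemma reach_bound_le rho T T' r : T' <= T -> reach_bound rho T r -> reach_bound rho T' r.
Proof. by move=> TT' H phi tau ? ?; apply: H => //; exact: le_trans TT'. Qed.

(** While the curve stays within [r + 1] it is a genuine trajectory, hence it is within [r]; the
    unit margin then allows a further step of fixed length. The truncation is never felt. *)
Lemma truncated_curve_traj (rho T r k M : R) phi :
  tame (trunc G (r + 1)) k M -> reach_bound rho T r -> 0 <= T -> `|phi 0| <= rho ->
  curve (trunc G (r + 1)) k M T phi -> traj G T phi.
Proof.
move=> tG Hr T0 phi0 cphi; have [_ M0 _ _ _] := tG.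
have Htraj s : s <= T -> (forall v, 0 <= v -> v <= s -> `|phi v| <= r + 1) -> traj G s phi.
  by move=> sT; apply: curve_traj tG _; exact: curve_le cphi.
apply: (Htraj T) => //.
suff H : (forall v, 0 <= v -> v <= 0 -> `|phi v| <= r + 1) ->
         (forall v, 0 <= v -> v <= T -> `|phi v| <= r + 1).
  apply: H => v v0 v0'; have -> : v = 0 by lra.
  have := Hr phi 0 (lexx _) T0 (traj0 phi) phi0; lra.
apply: (@cousin _ 0 T (fun s u => (forall v, 0 <= v -> v <= s -> `|phi v| <= r + 1) ->
         (forall v, 0 <= v -> v <= u -> `|phi v| <= r + 1))) => //.
  by move=> s t u _ _ _ _ h1 h2 /h1.
move=> x x0 xT; pose d := 1 / (2 * (M + 1)).
have d0 : 0 < d by rewrite divr_gt0//; lra.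
exists d => // s u s0 sx xu uT xs ux Hs v v0 vu.
have [vs|sv] := leP v s; first exact: Hs.
have sT : s <= T := le_trans sx xT.
have phis := Hr phi s s0 sT (Htraj _ sT Hs) phi0.
have [||| l2 _] := cphi s v; [lra..|].
have h2 : M * (v - s) <= 1.
  apply: (@le_trans _ _ (M * (2 * d))); first by rewrite ler_wpM2l//; lra.
  have -> : M * (2 * d) = M / (M + 1).
    by rewrite /d; field; rewrite gt_eqF//; lra.
  by rewrite ler_pdivrMr; lra.
have := ler_normD (phi v - phi s) (phi s); rewrite subrK; lra.
Qed.

Hypothesis fcG : forward_complete G.

(* An unbounded solution on [0, T[ has no proper extension, hence would be maximal. *)
Lemma halfopen_traj_bounded (T : R) phi : 0 < T -> (forall t, t < T -> traj G t phi) ->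
  exists r : R, forall t, 0 <= t -> t < T -> `|phi t| <= r.
Proof.
move=> T0 Ht; apply: contrapT => unb.
pose D := [set t : R | 0 <= t /\ (t%:E < T%:E)%E].
have sol : is_solution G (phi 0) D phi.
  split => //.
  - by right; exists T%:E; split => //; rewrite lee_fin ltW.
  - move=> a b ab abD.
    have [_ bT] : D b by apply: abD; rewrite /= in_itv/= lexx andbT.
    have [a0 _] : D a by apply: abD; rewrite /= in_itv/= lexx.
    by rewrite lte_fin in bT; have [ac _] := Ht b bT; exact: abs_cont_sub ac.
  pose tj (j : nat) : R := T - j.+1%:R^-1.
  have tjT j : tj j < T by rewrite ltrBlDr ltrDl invr_gt0.
  have /choice[N HN] : forall j : nat, exists N : set R, mu.-negligible N /\
      forall t, 0 <= t -> t <= tj j -> ~ N t -> derivable phi t 1 /\ G (phi t) ('D_1 phi t).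
    by move=> j; have [_] := Ht _ (tjT j).
  exists (\bigcup_j N j); split; first by apply: negligible_bigcup => j; case: (HN j).
  move=> t [t0]; rewrite lte_fin => tT Nt.
  have Tt : 0 < T - t by rewrite subr_gt0.
  have [j hj] : exists j : nat, j.+1%:R^-1 < T - t.
    by apply: (@filter_ex _ \oo); exact: (near_infty_natSinv_lt (PosNum Tt)).
  apply: (HN j).2 => //; first by rewrite /tj lerBrDr -lerBrDl ltW.
  by move=> Njt; apply: Nt; exists j.
have [|t [[_ tT] /ltW]] := @fcG (phi 0) D phi _ T; last by rewrite leNgt -lte_fin tT.
split => // -[D' [psi [solpsi [DD' [nD'D psiE]]]]].
have [t D't nDt] : exists2 t, D' t & ~ D t.
  by apply: contrapT => h; apply: nD'D => t D't; apply: contrapT => nDt; apply: h; exists t.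
have [dD' _ _ _] := solpsi; have [t0 D's] := solution_domainP dD' D't.
have Tt : T <= t by rewrite leNgt; apply/negP => tT; apply: nDt; split => //; rewrite lte_fin.
have [r _ br] := traj_bounded (solution_traj solpsi (D's T (ltW T0) Tt)).
apply: unb; exists r => u u0 uT; rewrite -psiE; first by apply: br => //; exact: ltW.
by split => //; rewrite lte_fin.
Qed.

(** Otherwise some trajectories blow up at times that exceed [T] by less and less or not at all.
    Their limit on [0, T[ is a trajectory, bounded by completeness, so shortly before [T] most of
    them are in a fixed ball; [traj_escape] keeps them bounded until their final time. *)
Lemma reach_bound_extend (rho T : R) : 0 <= rho -> 0 <= T ->
  (forall t, t < T -> exists r, reach_bound rho t r) ->
  exists c, 0 < c /\ exists r, reach_bound rho (T + c) r.
Proof.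
move=> rho0 T0 Hlt; apply: contrapT => nex.
have /choice[p Hp] : forall m : nat, exists p : R * (R -> V),
    [/\ 0 <= p.1, p.1 <= T + m.+1%:R^-1, traj G p.1 p.2, `|p.2 0| <= rho & m%:R < `|p.2 p.1|].
  move=> m; apply: contrapT => np; apply: nex; exists m.+1%:R^-1; split; first by rewrite invr_gt0.
  exists m%:R => phi tau tau0 tauT tphi phi0; rewrite leNgt; apply/negP => big.
  by apply: np; exists (tau, phi).
pose tau m := (p m).1; pose phi m := (p m).2.
have tau0 m : 0 <= tau m by case: (Hp m).
have tauT m : tau m <= T + m.+1%:R^-1 by case: (Hp m).
have tphi m : traj G (tau m) (phi m) by case: (Hp m).
have phi0 m : `|phi m 0| <= rho by case: (Hp m).
have big m : m%:R < `|phi m (tau m)| by case: (Hp m).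
have [U [UU ooU]] := nat_ultrafilter.
have large (c : R) : \forall m \near U, c < m%:R.
  by apply: ooU; exact: nbhs_infty_gtr.
(* A trajectory ending by time [t] would have its endpoint bounded by [r], against [big] for large
   [m]. *)
have past t r : t < T -> reach_bound rho t r ->
    \forall m \near U, t < tau m /\ forall u, 0 <= u -> u <= t -> `|phi m u| <= r.
  move=> tT Hr; have lr := large r; near=> m.
  have rm : r < m%:R by near: m.
  have tm : t < tau m.
    rewrite ltNge; apply/negP => taut.
    by have := Hr _ _ (tau0 m) taut (tphi m) (phi0 m); have := big m; lra.
  split => // u u0 ut; apply: Hr => //; apply: traj_le (tphi m); exact: le_trans (ltW tm).
(* The point is that [R0] does not depend on [eta]: the escape delay is fixed by [R0] before [t] is
   chosen. *)
have [R0 R00 HR0] : exists2 R0, 0 <= R0 & forall eta, 0 < eta -> exists t,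
    [/\ 0 <= t, T - eta < t & \forall m \near U, t <= tau m /\ `|phi m t| <= R0].
  (* For [T = 0] there is no earlier time on which to take a limit, and the initial ball itself
     serves. *)
  have [T00|TN0] := eqVneq T 0.
    exists rho => // eta eta0; exists 0; split => //; first lra.
    by apply: nearW.
  have {TN0} Tpos : 0 < T by rewrite lt_def TN0.
  pose phil t := lim (phi ^~ t @ U).
  have phicvg t : 0 <= t -> t < T -> phi ^~ t @ U --> phil t.
    move=> t0 tT; have [r Hr] := Hlt t tT.
    apply: (@ultra_bounded_cvg _ _ _ _ _ r); have := past t r tT Hr.
    by apply: filterS => m [_]; apply.
  have [R1 HR1] : exists r, forall t, 0 <= t -> t < T -> `|phil t| <= r.
    apply: halfopen_traj_bounded => // t tT; have [r Hr] := Hlt t tT.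
    have pst := past t r tT Hr.
    have [t0|t0] := leP 0 t; last by apply: traj_le (traj0 phil); exact: ltW.
    have r0 : 0 <= r.
      by have [m [_ /(_ 0 (lexx _) t0)]] := filter_ex pst; exact: le_trans.
    have [k [M tG]] := tame_trunc rG r0.
    apply: (curve_traj tG).
      move=> s u s0 su ut.
      have u0 := le_trans s0 su; have uT := le_lt_trans ut tT.
      apply: (chord_limit tG _ _ (phicvg s s0 (le_lt_trans su uT)) (phicvg u u0 uT)).
        by rewrite subr_ge0.
      move=> e e0; apply: filterS pst => m [tm bm].
      have [c1 [w Gw c2]] := traj_curve tG (traj_le (ltW tm) (tphi m)) bm s0 su ut.
      split; first by apply: (le_trans c1); rewrite addr0 lerDl ltW.
      by exists w => //; apply: (le_trans c2); rewrite addr0 lerDl ltW.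
    move=> u u0 ut; apply/ler_addgt0Pr => e e0.
    have uT := le_lt_trans ut tT.
    have [m [[_ /(_ u u0 ut) h1] h2]] : exists m, (t < tau m /\ forall u, 0 <= u -> u <= t -> `|phi m u| <= r)
        /\ `|phil u - phi m u| <= e.
      apply: (@filter_ex _ U); apply: filterI => //.
      by apply: cvgr_dist_le => //; exact: phicvg.
    have := ler_normD (phil u - phi m u) (phi m u); rewrite subrK; lra.
  have R10 : 0 <= R1 by apply: le_trans (HR1 0 (lexx _) Tpos).
  exists (R1 + 1); first lra.
  move=> eta eta0; pose t := Num.max 0 (T - eta / 2).
  have t0 : 0 <= t by rewrite le_max lexx.
  have tT : t < T by rewrite gt_max Tpos /=; lra.
  exists t; split => //; first by rewrite lt_max; apply/orP; right; lra.
  have [r Hr] := Hlt t tT; have pst := past t r tT Hr.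
  have cv : \forall m \near U, `|phil t - phi m t| <= 1 by apply: cvgr_dist_le => //; exact: phicvg.
  near=> m; split.
    by apply: ltW; have [] : t < tau m /\ forall u, 0 <= u -> u <= t -> `|phi m u| <= r by near: m.
  have h1 : `|phil t - phi m t| <= 1 by near: m.
  have := HR1 t t0 tT.
  have := ler_normB (phil t) (phil t - phi m t); rewrite opprB addrC subrK; lra.
have [M M0 HM] := traj_escape R00.
(* The remaining time [tau m - t] is below [2 * eta]: one [eta] before [T], one for the
   overshoot. *)
pose eta := 1 / (2 * (M + 1)).
have eta0 : 0 < eta by rewrite divr_gt0//; lra.
have [t [t0 tT near_t]] := HR0 eta eta0.
have l1 := large (R0 + 1).
have l2 : \forall m \near U, m.+1%:R^-1 < eta.
  by apply: ooU; exact: (near_infty_natSinv_lt (PosNum eta0)).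
have [m [[[ttau phit] h1] h2]] := filter_ex (filterI (filterI near_t l1) l2).
have := HM (tau m - t) (fun u => phi m (t + u)).
rewrite /= subr_ge0 addr0 [t + (_ - _)]addrC subrK => /(_ ttau (traj_shift rG t0 (tphi m)) phit).
have ME : M * (2 * eta) < 1.
  have -> : M * (2 * eta) = M / (M + 1).
    by rewrite /eta; field; rewrite gt_eqF//; lra.
  by rewrite ltr_pdivrMr; lra.
have Mt : M * (tau m - t) <= M * (2 * eta).
  by rewrite ler_wpM2l//; have := tauT m; move: h2; set q := _^-1; lra.
by move=> /(_ (le_lt_trans Mt ME)); have := big m; move: h1; set q := m%:R; lra.
Unshelve. all: by end_near. Qed.

Lemma reach_bounded (rho T : R) : 0 <= rho -> 0 <= T -> exists r, reach_bound rho T r.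
Proof.
move=> rho0 T0; pose E := [set t | 0 <= t /\ exists r, reach_bound rho t r].
have E0 : E 0.
  split => //; exists rho => phi tau tau0 tau0' _; have -> // : tau = 0 by lra.
apply: contrapT => nT.
have Eub : ubound E T.
  move=> t [t0 [r Hr]]; rewrite leNgt; apply/negP => Tt; apply: nT; exists r.
  exact: reach_bound_le (ltW Tt) Hr.
have hsE : has_sup E by split; [exists 0|exists T].
have s0 : 0 <= sup E by apply: sup_upper_bound.
have [|c [c0 [r Hr]]] := @reach_bound_extend rho (sup E) rho0 s0.
  move=> t tS; have e0 : 0 < sup E - t by rewrite subr_gt0.
  have [u [u0 [r Hr]] tu] := sup_adherent e0 hsE.
  by exists r; apply: reach_bound_le Hr; lra.
have : sup E + c <= sup E by apply: sup_upper_bound => //; split; [lra|exists r].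
lra.
Qed.

End bounded_reachability.

(** * Distance from the backward reachable set to Xo *)

Section barrier.
Variables (R : realType) (n : nat).
Notation V := 'rV[R]_n.
Variables (G : V -> set V) (Xo : set V).
Hypothesis rG : regular G.
Hypothesis fcG : forward_complete G.

Definition reach_dists (p : R * V) : set R :=
  [set d | exists s phi z, [/\ 0 <= s, s <= p.1, traj G s phi, phi 0 = p.2 &
                              Xo z /\ d = `|phi s - z|]].

Definition reach_dist (p : R * V) : R := inf (reach_dists p).

Lemma reach_dists_ge0 p : lbound (reach_dists p) 0.
Proof. by move=> _ [s [phi [z [_ _ _ _ [_ ->]]]]]. Qed.

Lemma reach_dists_neq0 p : Xo !=set0 -> 0 <= p.1 -> reach_dists p !=set0.
Proof.
move=> [z Xz] p0; exists `|p.2 - z|; exists 0, (fun=> p.2), z; split => //.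
exact: traj0.
Qed.

Lemma reach_dist_le p d : reach_dists p d -> reach_dist p <= d.
Proof. by apply: ge_inf; exists 0; exact: reach_dists_ge0. Qed.

Lemma reach_dist_initial p : 0 <= p.1 -> Xo p.2 -> reach_dist p <= 0.
Proof.
move=> p0 Xp; apply: reach_dist_le; exists 0, (fun=> p.2), p.2; split => //; first exact: traj0.
by split => //; rewrite subrr normr0.
Qed.

Lemma reach_dist_compare p q c : Xo !=set0 -> 0 <= p.1 ->
  (forall d, reach_dists p d -> exists2 d', reach_dists q d' & d' <= d + c) ->
  reach_dist q <= reach_dist p + c.
Proof.
move=> X0 p0 H; rewrite -lerBlDr; apply: lb_le_inf; first exact: reach_dists_neq0.
by move=> d /H[d' qd' h]; rewrite lerBlDr; apply: le_trans h; exact: reach_dist_le.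
Qed.

(** A minimising sequence has trajectories, durations and targets in [Xo]; all converge along one
    ultrafilter, and the limit endpoint lies in the closed set [Xo]. *)
Lemma reach_dist_attained t x : closed Xo -> Xo !=set0 -> 0 <= t -> reach_dist (t, x) <= 0 ->
  exists s phi, [/\ 0 <= s, s <= t, traj G s phi, phi 0 = x & Xo (phi s)].
Proof.
move=> clX X0 t0 d0.
have [r Hr] := reach_bounded rG fcG (normr_ge0 x) t0.
have r0 : 0 <= r.
  by apply: le_trans (Hr (fun=> x) 0 (lexx _) t0 (traj0 rG _) (lexx _)).
have [k [M tG]] := tame_trunc rG (addr_ge0 r0 ler01); have [k0 M0 _ _ _] := tG.
have hinf : has_inf (reach_dists (t, x)).
  by split; [exact: reach_dists_neq0|exists 0; exact: reach_dists_ge0].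
have /choice[p Hp] : forall m : nat, exists p : R * (R -> V) * V,
    [/\ 0 <= p.1.1 /\ p.1.1 <= t, p.1.2 0 = x, curve (trunc G (r + 1)) k M t p.1.2,
        Xo p.2 & `|p.1.2 p.1.1 - p.2| < m.+1%:R^-1].
  move=> m; have m0 : 0 < m.+1%:R^-1 :> R by rewrite invr_gt0.
  have [d [s [phi [z [s0 st tphi phi0 [Xz ->]]]]] dm] := inf_adherent m0 hinf.
  have br u : 0 <= u -> u <= s -> `|phi u| <= r + 1.
    move=> u0 us; apply: (@le_trans _ _ r); last lra.
    apply: Hr => //; [exact: le_trans us st|exact: traj_le tphi|by rewrite phi0].
  (* Tracking from the same initial point reproduces [phi] on [0, s] and extends it to the common
     interval [0, t]. *)
  have [psi [psi0 cpsi psiphi]] := curve_tracking tG x (traj_curve tG tphi br).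
  exists (s, psi, z); split => //=.
  have -> : psi s = phi s.
    apply/eqP; rewrite -subr_eq0 -normr_le0; apply: (le_trans (psiphi s s0 (lexx _))).
    by rewrite phi0 subrr normr0 mulr0.
  by apply: (lt_le_trans dm); rewrite gerDr.
pose s m := (p m).1.1; pose psi m := (p m).1.2; pose z m := (p m).2.
have s01 m : 0 <= s m /\ s m <= t by case: (Hp m).
have psi0 m : psi m 0 = x by case: (Hp m).
have cpsi m : curve (trunc G (r + 1)) k M t (psi m) by case: (Hp m).
have Xz m : Xo (z m) by case: (Hp m).
have zm m : `|psi m (s m) - z m| < m.+1%:R^-1 by case: (Hp m).
have [U [UU ooU]] := nat_ultrafilter.
have [sl /= slt scvg] : exists2 sl, `[0, t]%classic sl & s @ U --> sl.
  apply: ultra_compact_cvg; first exact: segment_compact.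
  by apply: nearW => m /=; rewrite in_itv/=; have [-> ->] := s01 m.
move: slt; rewrite in_itv/= => /andP[sl0 slt].
pose psil u := lim (psi ^~ u @ U).
have pcvg u : 0 <= u -> u <= t -> psi ^~ u @ U --> psil u.
  move=> u0 ut; apply: (@ultra_bounded_cvg _ _ _ _ _ (`|x| + M * t)); apply: nearW => m.
  have [l _] := cpsi m 0 u (lexx _) u0 ut; rewrite psi0 subr0 addr0 in l.
  have : M * u <= M * t by rewrite ler_wpM2l.
  have := ler_normD (psi m u - x) x; rewrite subrK; lra.
have psil0 : psil 0 = x.
  apply: cvg_lim => //; have -> : psi ^~ 0 = fun=> x by apply/funext => m.
  exact: cvg_cst.
have cpsil : curve (trunc G (r + 1)) k M t psil.
  move=> u v u0 uv vt.
  apply: (chord_limit tG _ _ (pcvg u u0 (le_trans uv vt)) (pcvg v (le_trans u0 uv) vt)).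
    by rewrite subr_ge0.
  move=> e e0; apply: nearW => m.
  have [c1 [w Gw c2]] := cpsi m u v u0 uv vt.
  split; first by apply: (le_trans c1); rewrite addr0 lerDl ltW.
  by exists w => //; apply: (le_trans c2); rewrite addr0 lerDl ltW.
exists sl, psil; split => //.
  by apply: traj_le slt _; apply: (truncated_curve_traj rG tG Hr) => //; rewrite psil0.
apply: (closed_cvg (u_ := z) (F := U)) clX _ _ _; first exact: nearW.
apply/cvgrPdist_le => e e0; have e30 : 0 < e / 3 by lra.
have n1 : \forall m \near U, m.+1%:R^-1 < e / 3.
  by apply: ooU; exact: (near_infty_natSinv_lt (PosNum e30)).
have n2 : \forall m \near U, `|psil sl - psi m sl| <= e / 3.
  by apply: cvgr_dist_le => //; exact: pcvg.
have n3 : \forall m \near U, `|sl - s m| <= e / 3 / (M + 1).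
  by apply: cvgr_dist_le => //; rewrite divr_gt0//; lra.
near=> m.
have h1 : m.+1%:R^-1 < e / 3 by near: m.
have h2 : `|psil sl - psi m sl| <= e / 3 by near: m.
have h3 : `|sl - s m| <= e / 3 / (M + 1) by near: m.
have h4 : `|psi m sl - psi m (s m)| <= M * `|sl - s m|.
  have [sm0 smt] := s01 m; have [ss|ss] := leP (s m) sl.
    by have [+ _] := cpsi m (s m) sl sm0 ss slt; rewrite addr0 ger0_norm ?subr_ge0.
  have [+ _] := cpsi m sl (s m) sl0 (ltW ss) smt; rewrite addr0 distrC.
  by rewrite [X in _ -> _ <= M * X]distrC ger0_norm ?subr_ge0// ltW.
have h5 : M * `|sl - s m| <= e / 3.
  by move: h3; rewrite ler_pdivlMr; [rewrite mulrDr mulr1 mulrC; have := normr_ge0 (sl - s m); lra|lra].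
have h6 := lt_trans (zm m) h1.
have -> : psil sl - z m = (psil sl - psi m sl) + (psi m sl - psi m (s m)) + (psi m (s m) - z m).
  by apply/rowP => j; rewrite !mxE; ring.
have := ler_normD (psil sl - psi m sl + (psi m sl - psi m (s m))) (psi m (s m) - z m).
have := ler_normD (psil sl - psi m sl) (psi m sl - psi m (s m)); lra.
Unshelve. all: by end_near. Qed.

Lemma norm_fst_le (U W : normedModType R) (p : U * W) : `|p.1| <= `|p|.
Proof. by rewrite [leRHS]prod_normE le_max lexx. Qed.

Lemma norm_snd_le (U W : normedModType R) (p : U * W) : `|p.2| <= `|p|.
Proof. by rewrite [leRHS]prod_normE le_max lexx orbT. Qed.

Lemma reach_dist_lipschitz : Xo !=set0 -> fun_loc_lipschitz reach_dist.
Proof.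
move=> X0 Ko /compact_bounded[c [_ Hc]] Ko0.
pose T := `|c| + 1.
have T0 : 0 <= T by rewrite addr_ge0.
have bK p : Ko p -> `|p| <= T by move=> /Hc; apply; rewrite /T; have := ler_norm c; lra.
have [r Hr] := reach_bounded rG fcG T0 T0.
have r0 : 0 <= r.
  by apply: le_trans (Hr (fun=> 0) 0 (lexx _) T0 (traj0 rG _) _); rewrite ?normr0.
have [k [M tG]] := tame_trunc rG (addr_ge0 r0 ler01); have [k0 M0 _ _ _] := tG.
(* [M] accounts for the difference of the horizons, the exponential for the difference of the
   initial points. *)
exists (M + expR (k * T)).
have main p q : Ko p -> Ko q -> reach_dist q <= reach_dist p + (M + expR (k * T)) * `|p - q|.
  move=> Kp Kq; have /= p0 := Ko0 _ Kp; have /= q0 := Ko0 _ Kq.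
  apply: reach_dist_compare => // _ [s [phi [z [s0 sp tphi phi0 [Xz ->]]]]].
  have pT : p.1 <= T by apply: le_trans (bK _ Kp); apply: le_trans (norm_fst_le p); exact: ler_norm.
  have sT := le_trans sp pT.
  have phi0T : `|phi 0| <= T by rewrite phi0; apply: le_trans (bK _ Kp); exact: norm_snd_le.
  have br u : 0 <= u -> u <= s -> `|phi u| <= r + 1.
    move=> u0 us; apply: (@le_trans _ _ r); last lra.
    by apply: Hr => //; [exact: le_trans us sT|exact: traj_le tphi].
  have cphi := traj_curve tG tphi br.
  have [psi [psi0 cpsi psiphi]] := curve_tracking tG q.2 cphi.
  (* A trajectory counted for [q] may last at most [q.1], so the tracking one is stopped early if
     necessary. *)
  pose s' := Num.min s q.1.
  have s'0 : 0 <= s' by rewrite le_min s0.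
  have s's : s' <= s by rewrite ge_min lexx.
  exists `|psi s' - z|.
    exists s', psi, z; split => //; first by rewrite ge_min lexx orbT.
    apply: (truncated_curve_traj rG tG (reach_bound_le (le_trans s's sT) Hr)) => //.
    by rewrite psi0; apply: le_trans (bK _ Kq); exact: norm_snd_le.
  have h1 : `|phi s - phi s'| <= M * `|p - q|.
    have [+ _] := cphi s' s s'0 s's (lexx _); rewrite addr0 => /le_trans; apply.
    rewrite ler_wpM2l//; apply: le_trans (norm_fst_le (p - q)).
    have [ss|qs] := leP s q.1; first by rewrite /s' min_l// subrr.
    have -> : s' = q.1 by rewrite /s' min_r// ltW.
    by apply: (@le_trans _ _ (p.1 - q.1)); [lra|exact: ler_norm].
  have h2 : `|psi s' - phi s'| <= expR (k * T) * `|p - q|.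
    apply: (le_trans (psiphi s' s'0 s's)); apply: ler_pM; rewrite ?expR_ge0//.
      by rewrite ler_expR ler_wpM2l// (le_trans s's).
    by rewrite phi0 distrC; exact: (norm_snd_le (p - q)).
  have -> : psi s' - z = (psi s' - phi s') - (phi s - phi s') + (phi s - z).
    by apply/rowP => j; rewrite !mxE; ring.
  have := ler_normD (psi s' - phi s' - (phi s - phi s')) (phi s - z).
  have := ler_normB (psi s' - phi s') (phi s - phi s').
  rewrite mulrDl; lra.
move=> p q Kp Kq; rewrite ler_distl; apply/andP; split.
  by have := main p q Kp Kq; lra.
by have := main q p Kq Kp; rewrite distrC.
Qed.

Lemma reach_dist_nonincreasing (phi : R -> V) (t0 r1 r2 : R) : Xo !=set0 ->
  0 <= t0 -> 0 <= r1 -> r1 <= r2 -> traj (oppF G) r2 phi ->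
  reach_dist (t0 + r2, phi r2) <= reach_dist (t0 + r1, phi r1).
Proof.
move=> X0 t00 r10 r12 tphi; rewrite -[leRHS]addr0.
apply: reach_dist_compare => //=; first lra.
move=> _ [s [psi [z [s0 st tpsi psi0 [Xz ->]]]]]; exists `|psi s - z|; last by rewrite addr0.
have d0 : 0 <= r2 - r1 by rewrite subr_ge0.
(* The backward path from [phi r2] to [phi r1]; prolonged by [psi], it competes in the infimum at
   the later point and fits its horizon. *)
have rev : traj G (r2 - r1) (fun t => phi (r1 + (r2 - r1 - t))).
  by have := traj_reverse (regular_opp rG) (traj_shift (regular_opp rG) r10 tphi); rewrite oppFK.
have psi0' : psi 0 = phi (r1 + (r2 - r1 - (r2 - r1))) by rewrite subrr addr0.
exists (r2 - r1 + s), (fun t => if t <= r2 - r1 then phi (r1 + (r2 - r1 - t)) else psi (t - (r2 - r1))), z.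
split => //=.
- by rewrite addr_ge0.
- by move: st => /=; lra.
- exact: (traj_concat rG d0 s0 rev tpsi psi0').
- by rewrite d0 subr0 addrC subrK.
(* At the endpoint the first branch is selected only when [s = 0], where both branches agree. *)
split => //; case: leP => [sle|_]; last by rewrite addrAC subrr add0r.
have -> : s = 0 by lra.
by rewrite addr0 psi0'.
Qed.

End barrier.

(** * The system augmented with time *)

Section augmented_system.
Variables (R : realType) (n : nat).
Notation V := 'rV[R]_n.
Notation mu := (@lebesgue_measure R).
Implicit Types (F : V -> set V).

Lemma derivable_fst (U W : normedModType R) (psi : R -> U * W) t : derivable psi t 1 ->
  derivable (fun s => (psi s).1) t 1 /\ 'D_1 (fun s => (psi s).1) t = ('D_1 psi t).1.
Proof.
move=> dpsi.
have cv : (fun h => h^-1 *: ((psi (h *: 1 + t)).1 - (psi t).1)) @ 0^' --> ('D_1 psi t).1.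
  exact: (cvg_comp _ _ dpsi (@cvg_fst _ _ _ _ _)).
by split; [apply/cvg_ex; eexists; exact: cv|exact: cvg_lim].
Qed.

Lemma derivable_snd (U W : normedModType R) (psi : R -> U * W) t : derivable psi t 1 ->
  derivable (fun s => (psi s).2) t 1 /\ 'D_1 (fun s => (psi s).2) t = ('D_1 psi t).2.
Proof.
move=> dpsi.
have cv : (fun h => h^-1 *: ((psi (h *: 1 + t)).2 - (psi t).2)) @ 0^' --> ('D_1 psi t).2.
  exact: (cvg_comp _ _ dpsi (@cvg_snd _ _ _ _ _)).
by split; [apply/cvg_ex; eexists; exact: cv|exact: cvg_lim].
Qed.

Lemma derivable_pair (U W : normedModType R) (f : R -> U) (g : R -> W) t :
  derivable f t 1 -> derivable g t 1 ->
  derivable (fun s => (f s, g s)) t 1 /\ 'D_1 (fun s => (f s, g s)) t = ('D_1 f t, 'D_1 g t).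
Proof.
move=> df dg.
have cv : (fun h => h^-1 *: ((f (h *: 1 + t), g (h *: 1 + t)) - (f t, g t))) @ 0^' -->
    ('D_1 f t, 'D_1 g t).
  exact: (cvg_pair df dg).
by split; [apply/cvg_ex; eexists; exact: cv|exact: cvg_lim].
Qed.

Lemma abs_cont_le (U W : normedModType R) (a b : R) (f : R -> U) (g : R -> W) :
  (forall s t, `|g t - g s| <= `|f t - f s|) -> abs_cont_on a b f -> abs_cont_on a b g.
Proof.
move=> H ac e e0; have [d d0 Hd] := ac e e0; exists d => // k u v h1 h2 h3.
by apply: le_lt_trans (Hd k u v h1 h2 h3); apply: ler_sum.
Qed.

Lemma aug_traj_snd F T psi : traj (aug_sys F) T psi -> traj F T (fun t => (psi t).2).
Proof.
move=> [ac [N [negN HN]]]; split.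
  by apply: abs_cont_le ac => s t; exact: (norm_snd_le (psi t - psi s)).
exists N; split => // t t0 tT Nt; have [d [_ Fd]] := HN t t0 tT Nt.
by have [? ->] := derivable_snd d.
Qed.

(** The clock is absolutely continuous with derivative 1 almost everywhere; the mean value theorem
    with the single velocity 1 gives its increment. *)
Lemma aug_traj_fst F T psi : 0 <= T -> traj (aug_sys F) T psi -> (psi T).1 = (psi 0).1 + T.
Proof.
move=> T0 [ac [N [negN HN]]].
have ac1 : abs_cont_on 0 T (fun t => (psi t).1 : R^o).
  by apply: abs_cont_le ac => s t; exact: (norm_fst_le (psi t - psi s)).
apply/eqP; rewrite -subr_eq0 -normr_le0; apply/ler_addgt0Pr => e e0; rewrite add0r.
have [||||w ->] := @abs_cont_mean_value R R^o 0 T _ [set 1] 1 N T0 ac1 negN _ _ _ _ e e0.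
- by exists 1.
- by move=> x y p q /= -> -> _ _ pq; rewrite -scalerDl pq scale1r.
- by move=> x /= ->; rewrite normr1.
- move=> t t0 tT Nt; have [d [d1 _]] := HN t t0 tT Nt.
  by have [? E] := derivable_fst d; rewrite /= in E *; split => //; rewrite E.
have -> : (psi T).1 - (psi 0).1 - (T - 0) *: (1 : R^o) = (psi T).1 - ((psi 0).1 + T).
  by rewrite -[_ *: _]/((T - 0) * 1) mulr1 subr0 opprD addrA.
by [].
Qed.

Lemma traj_aug F T M a phi : 0 <= M ->
  (forall s t, 0 <= s -> s <= t -> t <= T -> `|phi t - phi s| <= M * (t - s)) ->
  traj F T phi -> traj (aug_sys F) T (fun t => (a + t, phi t)).
Proof.
move=> M0 lip [_ [N [negN HN]]]; split.
  apply: (@lipschitz_abs_cont _ _ _ _ (M + 1)); first lra.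
  move=> s t s0 st tT; rewrite prod_normE /= ge_max; apply/andP; split.
    rewrite (_ : a + t - (a + s) = t - s); last ring.
    rewrite ger0_norm ?subr_ge0// ler_peMl ?subr_ge0//; lra.
  apply: (le_trans (lip s t s0 st tT)); rewrite ler_wpM2r ?subr_ge0//; lra.
exists N; split => // t t0 tT Nt; have [d Fd] := HN t t0 tT Nt.
have d1 : is_derive t 1 (fun u : R => a + u) 1.
  by rewrite -[1 in X in is_derive _ _ _ X]add0r; apply: is_deriveD.
have [dp E] := derivable_pair (@ex_derive _ _ _ _ _ _ _ d1) d.
by split => //; rewrite E; split => //=; rewrite derive_val.
Qed.

End augmented_system.

(** * Safety and barriers *)

Section safety.
Variables (R : realType) (n : nat).
Notation V := 'rV[R]_n.
Variables (F : V -> set V) (Xo Xu : set V).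

(** If a solution reaches [Xu], there is a last time [o] at which the barrier is nonpositive along
    it. Just after [o] the solution is in [U] but outside the sublevel set, so monotonicity keeps
    the barrier nonpositive: a contradiction. *)
Lemma barrier_safe (B : R * V -> R) : regular F ->
  barrier_candidate B Xo Xu -> fun_loc_lipschitz B -> property_star_star F B ->
  is_safe F Xo Xu.
Proof.
move=> rF [Bu Bo] lipB [U [[_ oU] [KU mono]]] x0 Xx0 D phi sol T DT XuT.
have [dD phi0 _ _] := sol; have [T0 _] := solution_domainP dD DT.
have tphi := solution_traj sol DT.
have [r r0 br] := traj_bounded tphi.
have [k [M tF]] := tame_trunc rF r0; have [_ M0 _ _ _] := tF.
have lip s t : 0 <= s -> s <= t -> t <= T -> `|phi t - phi s| <= M * (t - s).
  by move=> s0 st tT; have [] := traj_chord tF tphi br s0 st tT.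
have plip s t : 0 <= s -> s <= t -> t <= T ->
    `|(t, phi t) - (s, phi s)| <= (M + 1) * (t - s).
  move=> s0 st tT; rewrite prod_normE /= ge_max; apply/andP; split.
    rewrite ger0_norm ?subr_ge0// ler_peMl ?subr_ge0//; lra.
  apply: (le_trans (lip s t s0 st tT)); rewrite ler_wpM2r ?subr_ge0//; lra.
have cK : compact (`[0, T]%classic `*` [set x : V | `|x| <= r]).
  by apply: compact_setX; [exact: segment_compact|exact: ball_compact].
have [|kB HB] := lipB _ cK; first by move=> [t x] [/=]; rewrite in_itv/= => /andP[].
pose b t := B (t, phi t); pose c := `|kB| * (M + 1).
have c0 : 0 <= c by rewrite mulr_ge0//; lra.
have blip s t : 0 <= s -> s <= t -> t <= T -> `|b t - b s| <= c * (t - s).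
  move=> s0 st tT; have t0 := le_trans s0 st; have sT := le_trans st tT.
  apply: (le_trans (HB _ _ _ _)).
  - by split => /=; [rewrite in_itv/= t0 tT|exact: br].
  - by split => /=; [rewrite in_itv/= s0 sT|exact: br].
  apply: (@le_trans _ _ (`|kB| * `|(t, phi t) - (s, phi s)|)).
    by rewrite ler_wpM2r// ler_norm.
  by rewrite -mulrA ler_wpM2l// plip.
pose S := [set t | [/\ 0 <= t, t <= T & b t <= 0]].
have S0 : S 0 by split => //; apply: Bo => //; rewrite phi0.
have hsS : has_sup S by split; [exists 0|exists T => t []].
have o0 : 0 <= sup S by exact: sup_upper_bound.
have oT : sup S <= T by apply: ge_sup; [exists 0|move=> t []].
have bo : b (sup S) <= 0.
  apply/ler_addgt0Pr => e e0; rewrite add0r.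
  have [|t [t0 tT bt] ot] := @sup_adherent _ S (e / (c + 1)) _ hsS; first by rewrite divr_gt0//; lra.
  have ts : t <= sup S by exact: sup_upper_bound.
  have h : c * (sup S - t) <= e.
    have : sup S - t <= e / (c + 1) by lra.
    rewrite ler_pdivlMr; last lra.
    by rewrite mulrDr mulr1 mulrC; lra.
  by have := blip _ _ t0 ts oT; rewrite ler_distl => /andP[]; lra.
have bpos t : sup S < t -> t <= T -> 0 < b t.
  move=> ot tT; rewrite ltNge; apply/negP => bt.
  have : t <= sup S by apply: sup_upper_bound => //; split => //; lra.
  lra.
have bT : 0 < b T by exact: Bu.
have oltT : sup S < T.
  by rewrite lt_neqAle oT andbT; apply/eqP => E; move: bo; rewrite E; lra.
set o := sup S in o0 oT bo bpos oltT.
have Ko : sublevelK B (o, phi o) by split.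
have [e e0 He] := oU _ (KU _ Ko).
have near_curve d : 0 < d -> exists2 h, 0 < h & o + h <= T /\
    forall u, 0 <= u -> u <= h -> `|(o + u, phi (o + u)) - (o, phi o)| < d.
  move=> d0; pose h := Num.min (T - o) (d / 2 / (M + 1)).
  have h0 : 0 < h by rewrite lt_min subr_gt0 oltT /= !divr_gt0//; lra.
  have hT : h <= T - o by rewrite ge_min lexx.
  have hd : h <= d / 2 / (M + 1) by rewrite ge_min lexx orbT.
  exists h => //; split; first lra.
  move=> u u0 uh; have := plip o (o + u) o0; rewrite lerDl => /(_ u0).
  have -> : o + u - o = u by ring.
  move=> /(_ ltac:(lra)) /le_lt_trans; apply.
  have : u <= d / 2 / (M + 1) by exact: le_trans hd.
  by rewrite ler_pdivlMr; [rewrite mulrC; lra|lra].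
have [h h0 [hT Hh]] := near_curve e e0.
have toh : traj F h (fun u => phi (o + u)).
  by apply: traj_le (traj_shift rF o0 tphi); lra.
(* Solutions start at time 0, so the curve is restarted at [o], with its clock component starting at
   [o]. *)
have taug : traj (aug_sys F) h (fun u => (o + u, phi (o + u))).
  apply: (traj_aug _ M0) toh => s t s0 st th.
  by have := lip (o + s) (o + t); rewrite (_ : o + t - (o + s) = t - s); [apply; lra|ring].
have outside u : 0 <= u -> u <= h ->
    (U `\` rel_interior (sublevelK B)) (o + u, phi (o + u)).
  move=> u0 uh; split; first by apply: He => /=; [lra|exact: Hh].
  move=> [[_ /= Bou] [d d0 Hd]].
  (* Only [u = 0] is delicate: that point is in the sublevel set, but points of the curve
     arbitrarily close to it are not, so it is not interior. *)
  have [u0'|uN0] := eqVneq u 0; last first.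
    have : 0 < b (o + u) by apply: bpos; [rewrite ltrDl lt_def uN0|lra].
    by rewrite /b; lra.
  have [h' h'0 [h'T Hh']] := near_curve d d0.
  have [_ /= Bh'] : sublevelK B (o + h', phi (o + h')).
    by apply: Hd => /=; [lra|rewrite u0' addr0; apply: Hh'; lra].
  have : 0 < b (o + h') by apply: bpos; lra.
  by rewrite /b; lra.
have := mono _ _ _ (traj_solution (ltW h0) taug) (outside 0 (lexx _) (ltW h0)) h.
rewrite /= in_itv/= lexx (ltW h0) => /(_ isT outside 0 h (lexx _) (ltW h0) (lexx _)).
rewrite addr0; have := bpos (o + h) ltac:(lra) hT; rewrite /b in bo *; lra.
Qed.

Lemma safe_barrier : regular F -> forward_complete (oppF F) -> closed Xo ->
  is_safe F Xo Xu ->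
  exists B : R * V -> R,
    [/\ barrier_candidate B Xo Xu, fun_loc_lipschitz B & property_star_star F B].
Proof.
move=> rF fc clX safe; have rG := regular_opp rF.
(* With [Xo] empty the infimum would be that of the empty set, namely 0, which is not positive on
   [Xu]; the constant 1 is used instead. *)
have [X0|X0] := pselect (Xo !=set0); last first.
  exists (fun=> 1); split.
  - by split => // t x _ Xx; case: X0; exists x.
  - by move=> Ko _ _; exists 0 => p q _ _; rewrite subrr normr0 mul0r.
  exists [set p | 0 <= p.1]; split; first by split => // p _; exists 1.
  by split => // p [].
exists (reach_dist (oppF F) Xo); split.
- split=> [t x t0 Xx|t x t0 Xx]; last exact: reach_dist_initial.
  rewrite ltNge; apply/negP => d0.
  have [s [phi [s0 st tphi phi0 Xs]]] := reach_dist_attained rG fc clX X0 t0 d0.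
  have := traj_reverse rG tphi; rewrite oppFK => /(traj_solution s0) sol.
  apply: (safe _ _ _ _ sol s); first by rewrite subr0.
    by rewrite /= in_itv/= s0 lexx.
  by rewrite subrr phi0.
- exact: reach_dist_lipschitz.
(* The neighbourhood can be the whole half-space: this barrier is nonincreasing along every
   solution. *)
exists [set p | 0 <= p.1]; split; first by split => // p _; exists 1.
split => [p []//|p0 D psi sol [/= p00 _] s Ds _ r1 r2 r10 r12 r2s].
have [dD psi0 _ _] := sol; have [_ Dr] := solution_domainP dD Ds.
have r20 := le_trans r10 r12.
have t2 := solution_traj sol (Dr _ r20 r2s).
have E1 := aug_traj_fst r10 (traj_le r12 t2); have E2 := aug_traj_fst r20 t2.
have := @reach_dist_nonincreasing R n (oppF F) Xo rG (fun t => (psi t).2) (psi 0).1 r1 r2 X0.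
rewrite oppFK psi0 => /(_ p00 r10 r12 (aug_traj_snd t2)).
by rewrite -psi0 -E1 -E2; case: (psi r1) (psi r2) => [? ?] [].
Qed.

(** One empty value makes all values empty, by the Lipschitz property. A solution on {0} then has no
    extension, so it is maximal with bounded domain, against completeness. *)
Lemma backward_complete_neq0 (x : V) : sv_loc_lipschitz F -> backward_complete F -> F x !=set0.
Proof.
move=> lip bc; apply: contrapT => Fx0.
have Fy0 y v : ~ F y v.
  move=> Fv; apply: Fx0.
  have [k _ /(_ y x)] := lip _ (@ball_compact R n (Num.max `|x| `|y|)).
  rewrite /= !le_max !lexx orbT => /(_ isT isT _ Fv)[z [Fz _]].
  by exists z.
have [|t [/= ]] := bc 0 `[0, 0]%classic (fun=> 0) _ 0; last first.
  by rewrite in_itv/= => /le_anti -> ; rewrite ltxx.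
split; last first.
  move=> [D' [psi [[dD' _ _ [N [negN HN]]] [_ [nD _]]]]].
  have [t D't tn0] : exists2 t, D' t & t <> 0.
    apply: contrapT => h; apply: nD => t D't; rewrite /= in_itv/=.
    have -> : t = 0 by apply: contrapT => tn0; apply: h; exists t.
    by rewrite lexx.
  have [t0 D's] := solution_domainP dD' D't.
  have tpos : 0 < t by rewrite lt_def t0 andbT; apply/eqP.
  (* An extension would have no admissible derivative anywhere, so its exceptional null set would
     contain an interval of positive length. *)
  have sub : `[0, t]%classic `<=` N.
    move=> s; rewrite /= in_itv/= => /andP[s0 st]; apply: contrapT => Ns.
    by have [_ /Fy0] := HN s (D's s s0 st) Ns.
  have [A [mA A0 NA]] := negN.
  have : (lebesgue_measure (`[0%R, t]%classic : set R) <= 0)%E.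
    rewrite -A0; apply: le_measure; [|exact: mem_set|by move=> s /sub /NA].
    by apply: mem_set; exact: measurable_itv.
  by rewrite lebesgue_measure_itv/= lte_fin tpos lee_fin subr0; lra.
split => //; first by left; exists 0.
  move=> a b _ _ e e0; exists 1 => // k u v _ _ _.
  by rewrite big1// => i _; rewrite subrr normr0.
exists [set 0]; split.
  by apply/negligibleP; [exact: measurable_set1|exact: lebesgue_measure_set1].
by move=> t /=; rewrite in_itv/= => /le_anti <-.
Qed.

Lemma convex_setP (A : set V) v w (p q : R) : convex_set A ->
  A v -> A w -> 0 <= p -> 0 <= q -> p + q = 1 -> A (p *: v + q *: w).
Proof.
move=> cA Av Aw p0 q0 pq.
have p1 : p <= 1 by lra.
have -> : q = 1 - p by lra.
exact: set_mem (cA v w (Itv01 p0 p1) (mem_set Av) (mem_set Aw)).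
Qed.

End safety.

Theorem theorem3 (R : realType) (n : nat) (F : 'rV[R]_n -> set 'rV[R]_n)
    (Xo Xu : set 'rV[R]_n) :
  usc F -> sv_loc_lipschitz F ->
  (forall x, compact (F x) /\ convex_set (F x)) ->
  backward_complete F ->
  closed Xo -> Xo `&` Xu = set0 ->
  (is_safe F Xo Xu <->
   exists B : R * 'rV[R]_n -> R,
     [/\ barrier_candidate B Xo Xu, fun_loc_lipschitz B & property_star_star F B]).
Proof.
move=> _ lip cc bc clX _.
have rF : regular F.
  split => // x.
    by split; [exact: (cc x).1|exact: backward_complete_neq0].
  by move=> v w p q; exact: convex_setP (cc x).2.
split; first exact: safe_barrier.
by move=> [B [Bc Bl Bs]]; exact: barrier_safe Bc Bl Bs.
Qed.
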